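(* Fix integers $r,s$ with $0\le s<r$, and let $t=t(n)\ge 3$ be any sequence of integers. Then, as $n\to\infty$, $$\frac{\operatorname{mon}(C_t,G(n,r,s))}{\operatorname{hom}(C_t,G(n,r,s))}\to 1$$ if and only if $t=o\big(\min\{\sqrt{N},N_1\}\big)$, i.e. $t/\min\{\sqrt N,N_1\}\to 0$.
   Context: For integers $0\le s<r<n$, the generalized Johnson graph $G(n,r,s)$ is the simple graph whose vertices are the $r$-element subsets of $\{1,\dots,n\}$, two vertices $x,y$ being adjacent iff $|x\cap y|=s$. Here $r,s$ are constants and $n\to\infty$. Let $N=\binom{n}{r}$ be its number of vertices and $N_1=\binom{r}{s}\binom{n-r}{r-s}$ its (common) vertex degree. $C_t$ denotes the cycle on $t$ vertices. For graphs $H,G$, a homomorphism is a map $\varphi:V(H)\to V(G)$ sending edges to edges, and a monomorphism is an injective homomorphism; $\operatorname{hom}(H,G)$ and $\operatorname{mon}(H,G)$ denote their numbers. *)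

(* Defs.v *)
From HB Require Import structures.
From mathcomp Require Import all_boot all_order all_algebra.
From mathcomp Require Import all_classical all_reals all_analysis.
Set Implicit Arguments. Unset Strict Implicit. Unset Printing Implicit Defensive.

Definition hom_count (V W : finType) (eH : rel V) (eG : rel W) : nat :=
  #|[set f : {ffun V -> W} | [forall x, forall y, eH x y ==> eG (f x) (f y)]]|.

Definition mon_count (V W : finType) (eH : rel V) (eG : rel W) : nat :=
  #|[set f : {ffun V -> W} |
      injectiveb f && [forall x, forall y, eH x y ==> eG (f x) (f y)]]|.

(* The cycle C_t on vertex set {0,...,t-1}: i ~ i+1 (mod t). (For t >= 3.) *)
Definition cycle_rel (t : nat) : rel 'I_t :=
  fun i j => (j == ordS i) || (i == ordS j).

Notation jvert n r := {x : {set 'I_n} | #|x| == r}.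

Definition johnson_rel (n r s : nat) : rel (jvert n r) :=
  fun x y => #|val x :&: val y| == s.

Definition johnsonN (n r : nat) : nat := 'C(n, r).
Definition johnsonN1 (n r s : nat) : nat := 'C(r, s) * 'C(n - r, r - s).
Arguments cycle_rel t : clear implicits.
Arguments johnson_rel n r s : clear implicits.
Arguments johnsonN n r : clear implicits.
Arguments johnsonN1 n r s : clear implicits.

(* Main.v *)
Require Import Defs.
From HB Require Import structures.
From mathcomp Require Import all_boot all_order perm all_algebra.
From mathcomp Require Import all_classical all_reals all_analysis.
From mathcomp Require Import ring lra zify.
Set Implicit Arguments. Unset Strict Implicit. Unset Printing Implicit Defensive.
Import Order.TTheory GRing.Theory Num.Theory.
Import numFieldNormedType.Exports.
Local Open Scope ring_scope.

(** After division by [N1 ^ t], [hom(C_t, G)] is the expected number of vertices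
    from which simple random walk returns after [t] steps.  Write [p_d] for the
    [d]-step return probability; it does not depend on the vertex.

    If [t] is small compared to [min(sqrt N, N1)], the proportion of closed
    walks that are not injective is at most [t * sum_d p_d p_(t-d) / p_t].
    After [O(log n)] steps the walk is uniform up to a factor [1 + o(1)]
    (Doeblin: in [2r] steps every vertex is reached with probability at least a
    constant times [1/N]), and [sum_(2 <= d < t) p_d = O(1/N1 + t/N)], which
    settles [t >> log n].  For [t = O(log n)] one uses
    [p_d p_(t-d) = O(p_2 p_t) = O(p_t / N1)]: for even indices this is
    log-convexity of moments, and odd indices are compared to even ones because
    the spectrum of the walk is bounded below by a small negative constant.

    Conversely, cutting off the last [O(log n)] steps costs a factor [1 + o(1)],
    and a walk of length [t >= c N1] backtracks, while one of length
    [t >= c sqrt N] revisits its past, with probability bounded below. *)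

(** Plays the part of [(1 - u) ^ j <= exp (- j u)] without exponentials; the induction rests on
    [(1 - u) (1 + (j + 1) u) <= 1 + j u]. *)
Lemma one_sub_pow_le (R : realFieldType) (u : R) j : 0 <= u <= 1 ->
  (1 - u) ^+ j <= (1 + j%:R * u)^-1.
Proof.
move=> /andP[u0 u1]; have rhs0 i : 0 < 1 + i%:R * u by rewrite ltr_pwDl // mulr_ge0.
rewrite -[leRHS]mul1r ler_pdivlMr //.
elim: j => [|j IH]; first by rewrite expr0 mul0r addr0 mulr1.
apply: le_trans IH; rewrite exprSr -mulrA ler_wpM2l ?exprn_ge0 ?subr_ge0 //.
rewrite -natr1; have : 0 <= j%:R * u ^+ 2 by rewrite mulr_ge0 ?sqr_ge0.
have := sqr_ge0 u; rewrite !expr2; nra.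
Qed.

(** * Simple random walk as an iterated finite average *)

Section Walk.
Variables (R : realFieldType) (V : finType) (e : rel V) (D : nat).

Definition step (x y : V) : R := (e x y)%:R / D%:R.

(** Expectation of [F] over the next [d] vertices after [x]. The start is not listed, so for a
    closed walk the list is exactly the cyclic sequence of vertices. *)
Fixpoint walkE (d : nat) (x : V) (F : seq V -> R) : R :=
  if d is d'.+1 then \sum_y step x y * walkE d' y (fun s => F (y :: s))
  else F [::].

Definition prob d x y : R := walkE d x (fun s => (last x s == y)%:R).

Lemma step_ge0 x y : 0 <= step x y.
Proof. by rewrite /step mulr_ge0 ?invr_ge0 ?ler0n. Qed.

Lemma eq_walkE d x F G : (forall s, size s = d -> F s = G s) ->
  walkE d x F = walkE d x G.
Proof.
elim: d x F G => [|d IH] x F G h /=; first exact: h.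
by apply: eq_bigr => y _; congr (_ * _); apply: IH => s hs; apply: h; rewrite /= hs.
Qed.

Lemma le_walkE_path d x F G :
  (forall s, size s = d -> path e x s -> F s <= G s) ->
  walkE d x F <= walkE d x G.
Proof.
elim: d x F G => [|d IH] x F G h /=; first exact: h.
apply: ler_sum => y _; have [exy|] := boolP (e x y); last first.
  by move=> /negbTE nexy; rewrite /step nexy !mul0r.
apply: ler_wpM2l; first exact: step_ge0.
by apply: IH => s hs ps; apply: h; rewrite /= ?hs ?exy.
Qed.

Lemma le_walkE d x F G : (forall s, size s = d -> F s <= G s) ->
  walkE d x F <= walkE d x G.
Proof. by move=> h; apply: le_walkE_path => s hs _; apply: h. Qed.

Lemma walkE_ge0 d x F : (forall s, 0 <= F s) -> 0 <= walkE d x F.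
Proof.
elim: d x F => [|d IH] x F h /=; first exact: h.
by apply: sumr_ge0 => y _; rewrite mulr_ge0 ?step_ge0 ?IH.
Qed.

Lemma walkEZ d x F c : walkE d x (fun s => F s * c) = walkE d x F * c.
Proof.
elim: d x F => [//|d IH] x F /=.
by rewrite mulr_suml; apply: eq_bigr => y _; rewrite IH mulrA.
Qed.

Lemma walkED d x F G : walkE d x (fun s => F s + G s) = walkE d x F + walkE d x G.
Proof.
elim: d x F G => [//|d IH] x F G /=.
by rewrite -big_split; apply: eq_bigr => y _ /=; rewrite IH mulrDr.
Qed.

Lemma walkE_sum (I : Type) (l : seq I) (P : pred I) d x (F : I -> seq V -> R) :
  walkE d x (fun s => \sum_(i <- l | P i) F i s) = \sum_(i <- l | P i) walkE d x (F i).
Proof.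
elim: d x F => [//|d IH] x F /=.
rewrite exchange_big; apply: eq_bigr => y _ /=; by rewrite IH mulr_sumr.
Qed.

(** Markov property at time [a]. *)
Lemma walkE_add a b x F : walkE (a + b) x F =
  walkE a x (fun s => walkE b (last x s) (fun s' => F (s ++ s'))).
Proof.
elim: a x F => [//|a IH] x F /=.
by apply: eq_bigr => y _; rewrite IH.
Qed.

Lemma walkE_last d x g : walkE d x (fun s => g (last x s)) = \sum_z prob d x z * g z.
Proof.
transitivity (walkE d x (fun s => \sum_z (last x s == z)%:R * g z)).
  apply: eq_walkE => s _; rewrite (bigD1 (last x s)) //= eqxx mul1r big1 ?addr0 // => z.
  by rewrite eq_sym => /negbTE ->; rewrite mul0r.
by rewrite walkE_sum; apply: eq_bigr => z _; rewrite walkEZ.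
Qed.

Lemma prob_ge0 d x y : 0 <= prob d x y.
Proof. by apply: walkE_ge0 => s; exact: ler0n. Qed.

Lemma prob0 x y : prob 0 x y = (x == y)%:R. Proof. by []. Qed.

Lemma probD a b x y : prob (a + b) x y = \sum_z prob a x z * prob b z y.
Proof.
rewrite -walkE_last /prob walkE_add; apply: eq_walkE => s _; apply: eq_walkE => s' _.
by rewrite last_cat.
Qed.

Lemma prob1 x y : prob 1 x y = step x y.
Proof.
rewrite /prob /= (bigD1 y) //= eqxx mulr1 big1 ?addr0 // => z /negbTE ->.
by rewrite mulr0.
Qed.

Lemma probS d x y : prob d.+1 x y = \sum_z step x z * prob d z y.
Proof. by rewrite -add1n probD; apply: eq_bigr => z _; rewrite prob1. Qed.

Lemma probSr d x y : prob d.+1 x y = \sum_z prob d x z * step z y.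
Proof. by rewrite -addn1 probD; apply: eq_bigr => z _; rewrite prob1. Qed.

Lemma prob_morph (phi : V -> V) : bijective phi ->
  (forall x y, e (phi x) (phi y) = e x y) ->
  forall d x y, prob d (phi x) (phi y) = prob d x y.
Proof.
move=> bphi ephi; elim=> [|d IH] x y.
  by rewrite !prob0 (inj_eq (bij_inj bphi)).
rewrite !probS (reindex phi) /=; last exact/onW_bij.
by apply: eq_bigr => z _; rewrite IH /step ephi.
Qed.

(** * Walks on an undirected regular graph of degree [D] *)

Hypothesis esym : symmetric e.
Hypothesis ereg : forall x, #|[set y | e x y]| = D.
Hypothesis D_gt0 : (0 < D)%N.

Let DR_gt0 : 0 < D%:R :> R. Proof. by rewrite ltr0n. Qed.

Lemma prob_sym d x y : prob d x y = prob d y x.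
Proof.
elim: d x y => [|d IH] x y; first by rewrite !prob0 eq_sym.
rewrite probS probSr; apply: eq_bigr => z _.
by rewrite IH mulrC /step esym.
Qed.

Lemma step_sum x : \sum_y step x y = 1.
Proof.
rewrite /step -mulr_suml -natr_sum -big_mkcond /=.
have -> : (\sum_(i | e x i) 1 = D)%N.
  by rewrite sum1_card -(ereg x); apply: eq_card => y; rewrite inE.
by rewrite divff // gt_eqF.
Qed.

Lemma prob_sum d x : \sum_y prob d x y = 1.
Proof.
elim: d x => [|d IH] x.
  by rewrite (bigD1 x) //= prob0 eqxx big1 ?addr0 // => y; rewrite eq_sym prob0 => /negbTE->.
under eq_bigr do rewrite probS.
rewrite exchange_big /= -[RHS](step_sum x); apply: eq_bigr => y _.
by rewrite -mulr_sumr IH mulr1.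
Qed.

Lemma walkE_cst d x c : walkE d x (fun=> c) = c.
Proof.
by rewrite (walkE_last d x (fun=> c)) -mulr_suml prob_sum mul1r.
Qed.

Lemma step_le x y : step x y <= D%:R^-1.
Proof.
rewrite /step ler_piMl // ?invr_ge0 ?ler0n //; by case: (e x y).
Qed.

Lemma prob_le d x y : (0 < d)%N -> prob d x y <= D%:R^-1.
Proof.
case: d => // d _; rewrite probSr.
apply: le_trans (_ : \sum_z prob d x z * D%:R^-1 <= _).
  by apply: ler_sum => z _; rewrite ler_wpM2l ?prob_ge0 ?step_le.
by rewrite -mulr_suml prob_sum mul1r.
Qed.

(** Whatever the first step is, the second one goes back along the same edge with probability
    [1 / D]. *)
Lemma prob2_diag x : prob 2 x x = D%:R^-1.
Proof.
rewrite probS; under eq_bigr do rewrite prob1.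
transitivity (\sum_y step x y * D%:R^-1); last by rewrite -mulr_suml step_sum mul1r.
apply: eq_bigr => y _; rewrite /step [e y x]esym.
by case: (e x y); rewrite ?mul0r // !mul1r.
Qed.

Lemma walkE_tuple d x F :
  D%:R ^+ d * walkE d x F = \sum_(s : d.-tuple V | path e x s) F s.
Proof.
elim: d x F => [|d IH] x F /=.
  rewrite expr0 mul1r (big_pred1 [tuple]) // => s; by rewrite tuple0 /= eqxx.
rewrite mulr_sumr.
transitivity (\sum_y \sum_(s : d.-tuple V | e x y && path e y s) F (y :: s)).
  apply: eq_bigr => y _; rewrite /step exprSr; have [exy|nexy] := boolP (e x y) => /=.
    by rewrite -(IH y (fun s => F (y :: s))) mul1r -mulrA mulVKf // gt_eqF.
  by rewrite big_pred0_eq mul0r mul0r mulr0.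
rewrite pair_big_dep /=.
rewrite [RHS](reindex (fun p : V * d.-tuple V => cons_tuple p.1 p.2)) //=.
exists (fun s : d.+1.-tuple V => (thead s, behead_tuple s)) => [[y s] _|s _] /=.
  by congr (_, _); apply/val_inj.
by apply/val_inj; case: (tupleP s).
Qed.

(** All walks of length [t] have weight [D ^ - t], and closing up forces the start to be the last
    entry of [s]; summing over [x] thus leaves one term for each cyclic tuple. *)
Lemma closed_walkE t F : (0 < t)%N ->
  D%:R ^+ t * \sum_x walkE t x (fun s => (last x s == x)%:R * F s) =
  \sum_(s : t.-tuple V | cycle e s) F s.
Proof.
case: t => // t _; rewrite mulr_sumr; under eq_bigr do rewrite walkE_tuple.
rewrite (exchange_big_dep xpredT) //= [RHS]big_mkcond; apply: eq_bigr => s _.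
case: (tupleP s) => y s'; rewrite (cycle_path y) /= -[last y s']/(last y (y :: s')).
set l := last y _; rewrite big_mkcond (bigD1 l) //= eqxx mul1r big1 ?addr0 // => x.
by rewrite -/l eq_sym => /negbTE->; rewrite mul0r; case: ifP.
Qed.

(** * Union bound over collisions in a closed walk *)

(** A repetition at positions [i < j] is recorded by [i] and the gap [d = j - i]. *)
Lemma collision_le (x : V) s t : size s = t ->
  (~~ uniq s)%:R <= \sum_(i < t) \sum_(1 <= d < t | (i + d < t)%N)
     (nth x s i == nth x s (i + d)%N)%:R :> R.
Proof.
move=> st; have [_|] := boolP (uniq s).
  by do 2 (apply: sumr_ge0 => ? _).
move=> /(uniqPn x) [i [j [lij ljs eqij]]]; rewrite st in ljs.
have lit : (i < t)%N by lia.
rewrite (bigD1 (Ordinal lit)) //= -[leLHS]addr0 lerD //; last first.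
  by do 2 (apply: sumr_ge0 => ? _).
rewrite big_mkcond (bigD1_seq (j - i)%N) ?iota_uniq //=; last by rewrite mem_index_iota; lia.
rewrite subnKC ?(ltnW lij) // ljs eqij eqxx lerDl.
by apply: sumr_ge0 => d _; case: ifP => _; rewrite ?ler0n.
Qed.

(** Cut the walk at the two visits to the repeated vertex [z]. The middle piece is a closed walk of
    length [d]; the outer pieces, summed over the start [x], join into a closed walk of length
    [t - d] from [z]. Entry [i] of the list is reached after [i + 1] steps. *)
Lemma pair_collision (pi : nat -> R) t i d : (forall d x, prob d x x = pi d) ->
  (0 < d)%N -> (i + d < t)%N ->
  \sum_x walkE t x (fun s => (last x s == x)%:R * (nth x s i == nth x s (i + d)%N)%:R)
  = #|V|%:R * (pi d * pi (t - d)%N).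
Proof.
move=> piE d0 lt; have [c tE] : exists c, t = (i.+1 + (d + c))%N.
  by exists (t - (i.+1 + d))%N; lia.
transitivity (\sum_x \sum_z prob i.+1 x z * (pi d * prob c z x)).
  apply: eq_bigr => x _; rewrite tE walkE_add.
  transitivity (walkE i.+1 x (fun s1 => pi d * prob c (last x s1) x)); last first.
    by rewrite (walkE_last _ _ (fun z => pi d * prob c z x)).
  apply: eq_walkE => s1 s1i; rewrite walkE_add; set z := last x s1.
  transitivity (walkE d z (fun s2 => (last z s2 == z)%:R * prob c (last z s2) x)); last first.
    rewrite (walkE_last d z (fun w => (w == z)%:R * prob c w x)) (bigD1 z) //= eqxx mul1r.
    by rewrite piE big1 ?addr0 // => w /negbTE->; rewrite mul0r mulr0.
  apply: eq_walkE => s2 s2d; rewrite mulrC /prob -walkEZ; apply: eq_walkE => s3 _.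
  rewrite !last_cat -/z; congr (_ * (_ : bool)%:R).
  rewrite !nth_cat s1i ltnSn s2d; have -> : (i + d < i.+1)%N = false by lia.
  have -> : (i + d - i.+1 = d.-1)%N by lia.
  rewrite prednK // leqnn -[i]/(i.+1.-1) -s1i nth_last.
  rewrite -/z -s2d nth_last eq_sym; by case: (s2) s2d d0 => // <-.
rewrite exchange_big /=; under eq_bigr => z _.
  under eq_bigr => x _ do rewrite mulrCA [_ * prob c _ _]mulrC.
  rewrite -mulr_sumr -probD piE; over.
have -> : (t - d = c + i.+1)%N by lia.
by rewrite sumr_const mulr_natl.
Qed.

(** Dropping the constraint [i + d < t] costs nothing but a factor [t] for the position [i]. *)
Lemma collision_bound (pi : nat -> R) t : (forall d x, prob d x x = pi d) ->
  \sum_x walkE t x (fun s => (last x s == x)%:R * (~~ uniq s)%:R)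
  <= #|V|%:R * (t%:R * \sum_(1 <= d < t) pi d * pi (t - d)%N).
Proof.
move=> piE.
have pi0 d : (0 < #|V|)%N -> 0 <= pi d.
  by case/card_gt0P => x _; rewrite -(piE d x) prob_ge0.
apply: (@le_trans _ _ (\sum_(i < t) \sum_(1 <= d < t | (i + d < t)%N)
    #|V|%:R * (pi d * pi (t - d)%N))).
  apply: (@le_trans _ _ (\sum_x \sum_(i < t) \sum_(1 <= d < t | (i + d < t)%N) walkE t x
      (fun s => (last x s == x)%:R * (nth x s i == nth x s (i + d)%N)%:R))).
    apply: ler_sum => x _; rewrite [leRHS](_ : _ = walkE t x (fun s =>
       \sum_(i < t) \sum_(1 <= d < t | (i + d < t)%N)
       (last x s == x)%:R * (nth x s i == nth x s (i + d)%N)%:R)); last first.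
      by rewrite walkE_sum; apply: eq_bigr => i _; rewrite walkE_sum.
    apply: le_walkE => s st; under eq_bigr => i _ do rewrite -mulr_sumr.
    by rewrite -mulr_sumr ler_wpM2l // (collision_le x st).
  rewrite exchange_big; apply: ler_sum => i _; rewrite exchange_big /=.
  rewrite big_nat_cond [leRHS]big_nat_cond; apply: ler_sum => d /andP[/andP[d1 _] ?].
  by rewrite (pair_collision piE).
rewrite mulrCA [leRHS]mulr_natl.
apply: (@le_trans _ _ (\sum_(i < t) (#|V|%:R * \sum_(1 <= d < t) pi d * pi (t - d)%N)));
  last by rewrite sumr_const card_ord.
apply: ler_sum => i _; rewrite mulr_sumr big_mkcond /=; apply: ler_sum => d _.
case: ifP => // _; have [->|V0] := posnP #|V|; first by rewrite mul0r.
by rewrite !mulr_ge0 ?pi0.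
Qed.

(** The spectrum of [step] is at most 1: bound [f x * f y] by the mean of the squares, and use that
    rows and columns of [step] sum to 1. *)
Lemma quad_le (f : V -> R) : \sum_x \sum_y f x * step x y * f y <= \sum_x f x ^+ 2.
Proof.
apply: (@le_trans _ _ (\sum_x \sum_y (step x y * (f x ^+ 2 / 2) + step x y * (f y ^+ 2 / 2)))).
  apply: ler_sum => x _; apply: ler_sum => y _.
  rewrite [f x * _]mulrC -mulrA -mulrDr ler_wpM2l ?step_ge0 //.
  have := sqr_ge0 (f x - f y); rewrite !expr2; lra.
under eq_bigr do rewrite big_split /=; rewrite big_split /=.
under eq_bigr do rewrite -mulr_suml step_sum mul1r.
rewrite [X in _ + X]exchange_big /=.
under [X in _ + X]eq_bigr => y _.
  under eq_bigr => x _ do rewrite /step esym -/(step y x).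
  rewrite -mulr_suml step_sum mul1r; over.
rewrite -mulr_suml; set S := \sum_x _; lra.
Qed.

(** * Return probabilities as spectral moments *)

Section Moments.
Variables (pi : nat -> R) (v : V).
Hypothesis piE : forall d x, prob d x x = pi d.

Lemma sum_prob2 a b : \sum_y prob a v y * prob b v y = pi (a + b)%N.
Proof. by rewrite -(piE _ v) probD; apply: eq_bigr => y _; rewrite [prob b v y]prob_sym. Qed.

Lemma quad_prob a b : \sum_x \sum_y prob a v x * step x y * prob b v y = pi (a + b).+1.
Proof.
rewrite exchange_big /= -addSn -sum_prob2; apply: eq_bigr => y _.
by rewrite probSr mulr_suml.
Qed.

Lemma pi_ge0 d : 0 <= pi d. Proof. by rewrite -(piE d v) prob_ge0. Qed.

(** The moment is the squared norm of [prob j v], a vector whose entries sum to 1. *)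
Lemma pi_even_gt0 j : 0 < pi (j + j).
Proof.
rewrite lt_neqAle pi_ge0 andbT eq_sym -sum_prob2; apply/negP.
rewrite psumr_eq0; last by move=> y _; rewrite mulr_ge0 ?prob_ge0.
move=> /allP h; have := prob_sum j v; rewrite big1 => [|y _].
  by move=> /eqP; rewrite eq_sym oner_eq0.
by have := h y (mem_index_enum _); rewrite /= mulf_eq0 orbb => /eqP.
Qed.

(** Cauchy-Schwarz for the vectors [prob a v] and [prob b v], whose inner products are moments by
    [sum_prob2]. *)
Lemma pi_logconvex a b : pi (a + b) ^+ 2 <= pi (a + a) * pi (b + b).
Proof.
set al := pi (a + a); set be := pi (b + b); set ga := pi (a + b).
have be0 : 0 < be := pi_even_gt0 b.
have : 0 <= \sum_y (be * prob a v y - ga * prob b v y) ^+ 2.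
  by apply: sumr_ge0 => y _; exact: sqr_ge0.
have -> : \sum_y (be * prob a v y - ga * prob b v y) ^+ 2 =
    be ^+ 2 * al - 2 * be * ga * ga + ga ^+ 2 * be.
  transitivity (be ^+ 2 * (\sum_y prob a v y * prob a v y)
      - 2 * be * ga * (\sum_y prob a v y * prob b v y)
      + ga ^+ 2 * (\sum_y prob b v y * prob b v y)); last by rewrite !sum_prob2.
  rewrite !mulr_sumr -sumrB -big_split /=; apply: eq_bigr => y _; ring.
have -> : be ^+ 2 * al - 2 * be * ga * ga + ga ^+ 2 * be = be * (al * be - ga ^+ 2) by ring.
by rewrite pmulr_rge0 // subr_ge0.
Qed.

Lemma pi_odd_le j : pi (j + j).+1 <= pi (j + j).
Proof.
rewrite -quad_prob -sum_prob2; have := quad_le (prob j v).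
by under [X in _ <= X -> _]eq_bigr do rewrite expr2.
Qed.

(* The hypothesis says that the spectrum of [step] lies above [- c]; there
   [(l - c) ^ 2 * (l + c) * l ^ (2 j + 2)] is nonnegative. *)
Lemma pi_cubic (c : R) j : (forall f : V -> R,
    0 <= (\sum_x \sum_y f x * step x y * f y) + c * \sum_x f x ^+ 2) ->
  c ^+ 2 * (pi (j + j).+3 - c * pi (j + j).+2) <= pi (j + j).+4.+1 - c * pi (j + j).+4.
Proof.
move=> /(_ (fun y => prob j.+2 v y - c * prob j.+1 v y)) psd.
rewrite -subr_ge0; apply: (le_trans psd); rewrite le_eqVlt; apply/orP; left; apply/eqP.
have key a b : (\sum_x \sum_y (prob a v x - c * prob b v x) * step x y * (prob a v y - c * prob b v y))
    + c * \sum_x (prob a v x - c * prob b v x) ^+ 2 =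
  pi (a + a).+1 - c * pi (a + b).+1 - c * pi (b + a).+1 + c ^+ 2 * pi (b + b).+1 +
  c * (pi (a + a) - 2 * c * pi (a + b) + c ^+ 2 * pi (b + b)).
  rewrite -!quad_prob -!sum_prob2; move: (prob a v) (prob b v) => f g; congr (_ + c * _).
    rewrite !mulr_sumr -!sumrB -big_split; apply: eq_bigr => x _ /=.
    rewrite !mulr_sumr -!sumrB -big_split; apply: eq_bigr => y _ /=; ring.
  rewrite !mulr_sumr -!sumrB -big_split; apply: eq_bigr => x _ /=; ring.
rewrite key !addSn !addnS; ring.
Qed.

End Moments.

(** * Mixing and hitting under a Doeblin minorisation *)

Section Doeblin.
Variables (k : nat) (delta : R).
Hypothesis k_gt0 : (0 < k)%N.
Hypothesis delta_gt0 : 0 < delta.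
Hypothesis delta_le1 : delta <= 1.
Hypothesis V_gt0 : (0 < #|V|)%N.
Hypothesis minor : forall x y, delta / #|V|%:R <= prob k x y.

Let N := #|V|%:R : R.
Let N_gt0 : 0 < N. Proof. by rewrite ltr0n. Qed.
Let rho0 : 0 <= 1 - delta. Proof. by rewrite subr_ge0. Qed.

(** Split [prob k x] into the uniform part [delta / N], which contributes [delta * A], and a
    nonnegative remainder of mass [1 - delta], on which [g] is at most [A + U]. *)
Lemma doeblin_contract (g : V -> R) A U x : \sum_y g y = N * A ->
  (forall y, g y <= A + U) -> \sum_y prob k x y * g y <= A + (1 - delta) * U.
Proof.
move=> gA gU; rewrite -subr_ge0.
have -> : A + (1 - delta) * U - \sum_y prob k x y * g y =
    \sum_y (prob k x y - delta / N) * (A + U - g y).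
  transitivity (\sum_y (prob k x y * (A + U) - prob k x y * g y - delta / N * (A + U) + delta / N * g y)).
    rewrite big_split !sumrB /= -mulr_suml prob_sum mul1r sumr_const -mulr_sumr gA.
    rewrite -[_ *+ #|_|]mulr_natr -/N; field.
    by rewrite gt_eqF.
  by apply: eq_bigr => y _; ring.
by apply: sumr_ge0 => y _; rewrite mulr_ge0 ?subr_ge0.
Qed.

(** Iterated contraction: by symmetry the mean over the start is [1 / N], and as [b > 0] the initial
    excess is at most [1 / D]. Having [1 / D] here instead of 1 puts the factor [1 / D] into
    [return_sum]. *)
Lemma prob_ub j b x y : (0 < b)%N ->
  prob (j * k + b) x y <= N^-1 + (1 - delta) ^+ j / D%:R.
Proof.
move=> b0; elim: j x => [|j IH] x.
  by rewrite mul0n add0n expr0 mul1r; apply: le_trans (prob_le x y b0) _; rewrite lerDr invr_ge0 ltW.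
rewrite mulSn -addnA probD exprS -[_ * _ / _]mulrA; apply: doeblin_contract => //.
rewrite divff ?gt_eqF //; under eq_bigr do rewrite prob_sym; exact: prob_sum.
Qed.

(** The same contraction for [- prob], of mean [- 1 / N] and initial excess at most [1 / N]. *)
Lemma prob_lb j b x y : (1 - (1 - delta) ^+ j) / N <= prob (j * k + b) x y.
Proof.
elim: j x => [|j IH] x; first by rewrite expr0 subrr mul0r prob_ge0.
rewrite mulSn -addnA probD exprS -lerN2 -sumrN.
under eq_bigr do rewrite -mulrN.
have -> : - ((1 - (1 - delta) * (1 - delta) ^+ j) / N) =
   - N^-1 + (1 - delta) * ((1 - delta) ^+ j / N) by ring.
apply: doeblin_contract => [|z]; last first.
  by rewrite -[X in _ <= X]opprK lerN2; apply: le_trans (IH z); lra.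
rewrite sumrN mulrN divff ?gt_eqF //; under eq_bigr do rewrite prob_sym.
by rewrite prob_sum.
Qed.

(** The exponent is constant on blocks of length [k]; over [t] full blocks the sum is an exact
    geometric series. *)
Lemma geometric_block t : \sum_(i < t) (1 - delta) ^+ (i %/ k) <= k%:R / delta.
Proof.
have h : forall j, delta * \sum_(0 <= i < j * k) (1 - delta) ^+ (i %/ k) =
    k%:R * (1 - (1 - delta) ^+ j).
  elim=> [|j IH]; first by rewrite mul0n big_geq // expr0 subrr !mulr0.
  rewrite mulSn addnC (@big_cat_nat _ _ _ (j * k)) //= ?leq_addr // mulrDr IH.
  have -> : \sum_(j * k <= i < j * k + k) (1 - delta) ^+ (i %/ k) = k%:R * (1 - delta) ^+ j.
    rewrite -{1}[(j * k)%N]add0n big_addn addKn.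
    under eq_big_nat => i ik do rewrite addnC divnMDl // divn_small // addn0.
    by rewrite sumr_const_nat subn0 mulr_natl.
  by rewrite exprS; ring.
apply: (@le_trans _ _ (\sum_(0 <= i < t * k) (1 - delta) ^+ (i %/ k))).
  rewrite (@big_cat_nat _ _ _ t) //= ?leq_pmulr // big_mkord lerDl.
  by apply: sumr_ge0 => i _; rewrite exprn_ge0.
rewrite ler_pdivlMr // mulrC h ler_piMr // gerBl exprn_ge0 //.
Qed.

Lemma return_sum t x :
  \sum_(1 <= d < t) prob d x x <= t%:R / N + (k%:R / delta) / D%:R.
Proof.
rewrite big_add1; apply: (@le_trans _ _ (\sum_(0 <= i < t.-1) (N^-1 + (1 - delta) ^+ (i %/ k) / D%:R))).
  (* With [d = i + 1], the remainder left to [prob_ub] is [i %% k + 1], hence positive. *)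
  by apply: ler_sum => i _; rewrite {1}(divn_eq i k) -addnS prob_ub.
rewrite big_split /= sumr_const_nat subn0 -[_ *+ t.-1]mulr_natl big_mkord -mulr_suml.
by rewrite lerD // ler_pM2r ?invr_gt0 // ?ler_nat ?leq_pred ?geometric_block.
Qed.

(** Only the endpoint of each block of [k] steps is inspected: it lies in [S] with probability at
    least [delta * size S / N], whatever came before. *)
Lemma avoid_le j (S : seq V) y : uniq S ->
  walkE (j * k) y (fun s => (~~ has (mem S) s)%:R) <= (1 - delta * (size S)%:R / N) ^+ j.
Proof.
move=> uS; have SN : (size S <= #|V|)%N by rewrite -(card_uniqP uS) max_card.
have base0 : 0 <= 1 - delta * (size S)%:R / N.
  rewrite subr_ge0 ler_pdivrMr // mul1r; apply: (@le_trans _ _ (1 * (size S)%:R)).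
    by rewrite ler_wpM2r.
  by rewrite mul1r ler_nat.
elim: j y => [|j IH] y; first by rewrite /= ?expr0.
rewrite mulSn walkE_add.
set B := _ ^+ j in IH.
apply: (@le_trans _ _ (walkE k y (fun s => (last y s \notin S)%:R * B))).
  apply: le_walkE => s sk; case: (boolP (last y s \in S)) => yS /=; last first.
    rewrite mul1r; apply: le_trans (IH (last y s)).
    by apply: le_walkE => s' _; rewrite has_cat negb_or; case: has; rewrite ?ler0n.
  rewrite mul0r -[leRHS](mul0r 0) -[leRHS](walkE_cst (j * k) (last y s)).
  apply: le_walkE => s' _; suff -> : has (mem S) (s ++ s') by rewrite mul0r.
  rewrite has_cat; apply/orP; left; apply/hasP; exists (last y s) => //.
  by case: (s) sk k_gt0 => [<- //|a l] _ _ /=; rewrite mem_last.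
rewrite walkEZ exprS ler_wpM2r ?exprn_ge0 //.
rewrite (walkE_last _ _ (fun z => (z \notin S)%:R)).
rewrite (bigID (mem S)) /= big1 ?add0r => [|z ->]; last by rewrite mulr0.
have pS : \sum_(z in S) prob k y z + \sum_(z | z \notin S) prob k y z = 1.
  by rewrite -[RHS](prob_sum k y) [RHS](bigID (mem S)).
have -> : \sum_(z | z \notin S) prob k y z * (z \notin S)%:R = \sum_(z | z \notin S) prob k y z.
  by apply: eq_bigr => z ->; rewrite mulr1.
have : delta * (size S)%:R / N <= \sum_(z in S) prob k y z; last by lra.
apply: (@le_trans _ _ (\sum_(z in S) delta / N)); last exact: ler_sum.
by rewrite sumr_const (card_uniqP uS) -[leRHS]mulr_natr mulrAC.
Qed.

(** Birthday argument: the first [M] vertices, if distinct, form a set that the following [j] blocks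
    have to avoid. *)
Lemma uniq_birthday M j x :
  walkE (M + j * k) x (fun s => (uniq s)%:R) <= (1 + j%:R * (delta * M%:R / N))^-1.
Proof.
rewrite walkE_add; set u := delta * _ / N.
have u0 : 0 <= u by rewrite /u; do !apply: mulr_ge0; rewrite ?invr_ge0 ?ler0n ?(ltW delta_gt0) ?(ltW N_gt0).
have rhs0 : 0 < 1 + j%:R * u by rewrite ltr_pwDl // mulr_ge0.
rewrite -[leRHS](walkE_cst M x); apply: le_walkE => s sM.
have [us|nus] := boolP (uniq s); last first.
  rewrite [leLHS](_ : _ = walkE (j * k) (last x s) (fun=> 0)); last first.
    by apply: eq_walkE => s' _; rewrite cat_uniq (negbTE nus).
  by rewrite walkE_cst invr_ge0 ltW.
apply: (@le_trans _ _ ((1 - u) ^+ j)).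
  rewrite /u -sM; apply: le_trans (avoid_le j (last x s) us).
  apply: le_walkE => s' _; rewrite cat_uniq us /=; case: has => //=.
  by case: uniq.
have u1 : u <= 1.
  rewrite ler_pdivrMr // mul1r; apply: (@le_trans _ _ (1 * M%:R)); first by rewrite ler_wpM2r.
  by rewrite mul1r ler_nat -sM -(card_uniqP us) max_card.
by apply: one_sub_pow_le; rewrite u0.
Qed.

End Doeblin.

(** * Injective walks never backtrack *)

(** Here [w] and [y] are the last two vertices visited; each step returns to the earlier one with
    probability [1 / D], which ends injectivity. *)
Lemma nobacktrack_le d w y : e w y ->
  walkE d y (fun s => (uniq [:: w, y & s])%:R) <= (1 - D%:R^-1) ^+ d.
Proof.
have D1 : 0 <= 1 - D%:R^-1 :> R by rewrite subr_ge0 invf_le1 // ler1n.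
elim: d w y => [|d IH] w y wy; first by rewrite expr0 /=; case: (~~ _).
rewrite exprS; apply: (@le_trans _ _ (\sum_z step y z * (z != w)%:R * (1 - D%:R^-1) ^+ d)).
  apply: ler_sum => z _; have [yz|/negbTE nyz] := boolP (e y z); last first.
    by rewrite /step nyz !mul0r.
  rewrite -mulrA ler_wpM2l ?step_ge0 //.
  have [->|zw] /= := eqVneq z w.
    rewrite mul0r -[leRHS](walkE_cst d w); apply: le_walkE => s _.
    by rewrite !inE eqxx !orbT.
  rewrite mul1r; apply: le_trans (IH y z yz).
  by apply: le_walkE => s _; rewrite /=; case: (w \notin _).
rewrite -mulr_suml ler_wpM2r ?exprn_ge0 //.
have yS : step y w + \sum_(z | z != w) step y z = 1.
  by rewrite -[RHS](step_sum y) [RHS](bigD1 w).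
rewrite (bigD1 w) //= eqxx mulr0 add0r.
have : step y w = D%:R^-1 by rewrite /step esym wy mul1r.
move=> wE; have -> : 1 - D%:R^-1 = \sum_(z | z != w) step y z.
  by apply/eqP; rewrite subr_eq addrC -wE yS.
apply: ler_sum => z zw.
by rewrite zw mulr1.
Qed.

(** The start is not listed, so two steps pass before two consecutive listed vertices are
    available. *)
Lemma uniq_nobacktrack d x :
  walkE d.+2 x (fun s => (uniq s)%:R) <= (1 - D%:R^-1) ^+ d.
Proof.
have -> : (1 - D%:R^-1) ^+ d = \sum_y step x y * (\sum_z step y z * (1 - D%:R^-1) ^+ d) :> R.
  under eq_bigr do rewrite -mulr_suml step_sum mul1r.
  by rewrite -mulr_suml step_sum mul1r.
apply: ler_sum => y _; rewrite ler_wpM2l ?step_ge0 //; apply: ler_sum => z _.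
have [yz|/negbTE nyz] := boolP (e y z); last by rewrite /step nyz !mul0r.
by rewrite ler_wpM2l ?step_ge0 // nobacktrack_le.
Qed.

End Walk.

(** * Log-convex sequences and products of moments *)

(** Log-convexity makes the ratios of consecutive terms nondecreasing; denominators are cleared
    here. *)
Lemma logconvex_ratio (R : realFieldType) (a : nat -> R) : (forall i, 0 < a i) ->
  (forall i, a i.+1 ^+ 2 <= a i * a i.+2) ->
  forall i j, (i <= j)%N -> a i.+1 * a j <= a i * a j.+1.
Proof.
move=> a0 ac i j /subnK <-; elim: (j - i)%N => {j} [|j IH]; first by rewrite add0n mulrC.
rewrite -(ler_pM2r (a0 (j + i).+1)) addSn.
apply: (@le_trans _ _ (a i.+1 * (a (j + i)%N * a (j + i).+2))).
  by rewrite -mulrA -expr2 ler_pM2l.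
rewrite mulrA [leRHS]mulrAC ler_pM2r //.
Qed.

(** Moving one unit from the smaller index to the larger can only increase the product; this is
    repeated until the smaller index is 1. *)
Lemma logconvex_prod (R : realFieldType) (a : nat -> R) : (forall i, 0 < a i) ->
  (forall i, a i.+1 ^+ 2 <= a i * a i.+2) ->
  forall i j, a i.+1 * a j.+1 <= a 1%N * a (i + j).+1.
Proof.
move=> a0 ac i j; wlog ij : i j / (i <= j)%N => [h|].
  by case/orP: (leq_total i j) => /h //; rewrite mulrC addnC.
elim: i j ij => [//|i IH] j ij; rewrite addSnnS.
apply: le_trans (IH _ _); last lia.
by apply: logconvex_ratio => //; lia.
Qed.

Section MomentSequence.
Variables (R : realFieldType) (pi : nat -> R) (c : R).
Hypothesis c_gt0 : 0 < c.
Hypothesis c_le1 : c <= 1.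
Hypothesis pi_ge0 : forall d, 0 <= pi d.
Hypothesis pi_gt0 : forall j, 0 < pi j.*2.
Hypothesis pi1 : pi 1 = 0.
Hypothesis pi_conv : forall a b, pi (a + b) ^+ 2 <= pi (a + a) * pi (b + b).
Hypothesis pi_odd : forall j, pi (j + j).+1 <= pi (j + j).
Hypothesis pi_cubic : forall j,
  c ^+ 2 * (pi (j + j).+3 - c * pi (j + j).+2) <= pi (j + j).+4.+1 - c * pi (j + j).+4.
Hypothesis pi3 : c * pi 2 <= pi 3.

Let even_conv j : pi j.+1.*2 ^+ 2 <= pi j.*2 * pi j.+2.*2.
Proof. have := pi_conv j j.+2; by rewrite addnS addnC -!addnn !addnS !addSn. Qed.

(** [pi_cubic] passes nonnegativity of [pi (2 i + 1) - c * pi (2 i)] from one [i] to the next, and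
    [pi3] starts the induction. *)
Let pi_odd_ge j : c * pi j.+1.*2 <= pi j.+1.*2.+1.
Proof.
rewrite -subr_ge0; elim: j => [|j IH]; first by rewrite subr_ge0.
have := pi_cubic j; rewrite !doubleS -addnn => h; apply: le_trans h.
by rewrite mulr_ge0 ?sqr_ge0 //; move: IH; rewrite doubleS -addnn.
Qed.

(** Ratios of consecutive even moments are nondecreasing, and the first is at least [c ^ 2] because
    [pi 3 ^ 2 <= pi 2 * pi 4] and [c * pi 2 <= pi 3]. *)
Let pi_even_ge j : c ^+ 2 * pi j.+1.*2 <= pi j.+2.*2.
Proof.
have h0 : c ^+ 2 * pi 2 <= pi 4.
  have h := pi_conv 1 2; rewrite -(ler_pM2l (pi_gt0 1)) /=.
  apply: le_trans h; rewrite mulrCA -expr2 -exprMn ler_pXn2r // nnegrE //.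
  by rewrite mulr_ge0 // ltW.
elim: j => [//|j IH].
rewrite -(ler_pM2l (pi_gt0 j.+1)); apply: le_trans (even_conv _).
by rewrite mulrA [_ * c ^+ 2]mulrC expr2 ler_pM2r.
Qed.

Let even_prod i j : pi i.+1.*2 * pi j.+1.*2 <= pi 2 * pi (i + j).+1.*2.
Proof. exact: (@logconvex_prod _ (fun j => pi j.*2)). Qed.

Let pow_le a b : (a <= b)%N -> c ^+ b <= c ^+ a.
Proof. by move=> ab; apply: ler_wiXn2l => //; apply: ltW. Qed.

Lemma moment_gt0 t : (1 < t)%N -> 0 < pi t.
Proof.
move=> t1; have := odd_double_half t; case: odd => <-; last by rewrite add0n.
have -> : (t./2 = (t./2).-1.+1)%N by lia.
by rewrite add1n; apply: lt_le_trans (pi_odd_ge _); rewrite mulr_gt0.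
Qed.

(** Lower each odd index by one, multiply with [even_prod], then climb back to index [t] at a cost
    of [c ^ 2] for two units and [c] for a last odd unit. Two odd indices are the worst case and
    give [c ^ 4]; an index 1 makes the product vanish. *)
Lemma moment_prod_le d t : (0 < d < t)%N -> c ^+ 4 * (pi d * pi (t - d)) <= pi 2 * pi t.
Proof.
move=> /andP[d0 dt]; have c0 : 0 <= c := ltW c_gt0.
have rhs0 : 0 <= pi 2 * pi t by rewrite mulr_ge0.
have [->|d1] := eqVneq d 1%N; first by rewrite pi1 mul0r mulr0.
have [->|d2] := eqVneq (t - d)%N 1%N; first by rewrite pi1 !mulr0.
set u := (t - d)%N in d2 *; have {rhs0} -> : t = (d + u)%N by lia.
have {dt} u0 : (0 < u)%N by lia.
clearbody u; clear t.
have oddodd i j : c ^+ 4 * (pi i.+1.*2.+1 * pi j.+1.*2.+1) <= pi 2 * pi (i.+1.*2.+1 + j.+1.*2.+1).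
  apply: (@le_trans _ _ (c ^+ 4 * (pi 2 * pi (i + j).+1.*2))).
    rewrite ler_wpM2l ?exprn_ge0 //; apply: le_trans (even_prod i j).
    by rewrite ler_pM // -addnn pi_odd.
  have -> : (i.+1.*2.+1 + j.+1.*2.+1 = (i + j).+3.*2)%N by lia.
  rewrite mulrCA ler_wpM2l // (_ : 4 = 2 + 2)%N // exprD -mulrA.
  apply: le_trans (pi_even_ge _); rewrite ler_wpM2l ?exprn_ge0 //.
have oddeven i j : c ^+ 4 * (pi i.+1.*2.+1 * pi j.+1.*2) <= pi 2 * pi (i.+1.*2.+1 + j.+1.*2).
  apply: (@le_trans _ _ (c ^+ 3 * (pi 2 * pi (i + j).+1.*2))).
    rewrite ler_pM ?exprn_ge0 ?mulr_ge0 ?pow_le //; apply: le_trans (even_prod i j).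
    by rewrite ler_pM // -addnn pi_odd.
  have -> : (i.+1.*2.+1 + j.+1.*2 = (i + j).+2.*2.+1)%N by lia.
  rewrite mulrCA ler_wpM2l // exprS -mulrA; apply: le_trans (pi_odd_ge _).
  by rewrite ler_wpM2l.
have eveneven i j : c ^+ 4 * (pi i.+1.*2 * pi j.+1.*2) <= pi 2 * pi (i.+1.*2 + j.+1.*2).
  apply: (@le_trans _ _ (c ^+ 2 * (pi 2 * pi (i + j).+1.*2))).
    by rewrite ler_pM ?exprn_ge0 ?mulr_ge0 ?pow_le.
  have -> : (i.+1.*2 + j.+1.*2 = (i + j).+2.*2)%N by lia.
  by rewrite mulrCA ler_wpM2l.
have parity n : (0 < n)%N -> n != 1%N -> (exists i, n = i.+1.*2.+1) \/ (exists i, n = i.+1.*2).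
  move=> n0 n1; have := odd_double_half n; case: odd => nE.
    by left; exists (n./2).-1; lia.
  by right; exists (n./2).-1; lia.
case: (parity d d0 d1) => -[i ->]; case: (parity u u0 d2) => -[j ->] //.
by rewrite [pi i.+1.*2 * _]mulrC addnC.
Qed.

End MomentSequence.

(** * Homomorphisms from a cycle as cyclic tuples *)

Lemma cycle_tupleE (V : finType) (e : rel V) t (s : t.-tuple V) :
  cycle e s = [forall i : 'I_t, e (tnth s i) (tnth s (ordS i))].
Proof.
case: t s => [|t] s; first by rewrite tuple0; apply/esym/forallP => -[].
case: (tupleP s) => x p; rewrite /cycle /=.
have nthS i : (i <= t)%N -> nth x (rcons p x) i = nth x (x :: p) (i.+1 %% t.+1).
  move=> it; rewrite nth_rcons size_tuple; case: ltngtP it => // [it|->] _; last by rewrite modnn.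
  by rewrite modn_small.
have nth0 i : (i <= t)%N -> nth x (x :: rcons p x) i = nth x (x :: p) i.
  case: i => // i it /=; by rewrite nth_rcons size_tuple it.
have szp : size (rcons p x) = t.+1 by rewrite size_rcons size_tuple.
apply/(pathP x)/forallP => [h i|h i].
  have it : (i < size (rcons p x))%N by rewrite szp.
  by have := h i it; rewrite nthS ?nth0 -1?ltnS // !(tnth_nth x).
rewrite szp => it; have := h (Ordinal it).
by rewrite nthS ?nth0 // !(tnth_nth x).
Qed.

Lemma cycle_homE (V : finType) (e : rel V) t (f : {ffun 'I_t -> V}) : symmetric e ->
  [forall x, forall y, cycle_rel t x y ==> e (f x) (f y)] = cycle e (tuple_of_finfun f).
Proof.
move=> esym; rewrite cycle_tupleE; apply/forallP/forallP => [h i|h i].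
  by have /forallP/(_ (ordS i)) := h i; rewrite /cycle_rel eqxx !tnth_mktuple.
apply/forallP => j; apply/implyP => /orP[] /eqP ->.
  by have := h i; rewrite !tnth_mktuple.
by have := h j; rewrite !tnth_mktuple esym.
Qed.

Lemma hom_count_cycle (V : finType) (e : rel V) t : symmetric e ->
  hom_count (cycle_rel t) e = #|[set s : t.-tuple V | cycle e s]|.
Proof.
move=> esym; rewrite /hom_count -(on_card_preimset (f := @tuple_of_finfun V t)); last first.
  by apply: onW_bij; exists (@finfun_of_tuple V t); [exact: tuple_of_finfunK|exact: finfun_of_tupleK].
by apply: eq_card => f; rewrite !inE cycle_homE.
Qed.

Lemma mon_count_cycle (V : finType) (e : rel V) t : symmetric e ->
  mon_count (cycle_rel t) e = #|[set s : t.-tuple V | cycle e s && uniq s]|.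
Proof.
move=> esym; rewrite /mon_count -(on_card_preimset (f := @tuple_of_finfun V t)); last first.
  by apply: onW_bij; exists (@finfun_of_tuple V t); [exact: tuple_of_finfunK|exact: finfun_of_tupleK].
by apply: eq_card => f; rewrite !inE cycle_homE // andbC; congr (_ && _).
Qed.

(** * Cycle counts in terms of closed walks *)

Section Cycles.
Variables (R : realFieldType) (V : finType) (e : rel V) (D : nat).
Hypothesis esym : symmetric e.
Hypothesis ereg : forall x, #|[set y | e x y]| = D.
Hypothesis D_gt0 : (0 < D)%N.
Hypothesis V_gt0 : (0 < #|V|)%N.

Local Notation prob := (prob R e D).
Local Notation walkE := (walkE (R := R) e D).
Let hom t : R := (hom_count (cycle_rel t) e)%:R.
Let mon t : R := (mon_count (cycle_rel t) e)%:R.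
Let N : R := #|V|%:R.
Let N_gt0 : 0 < N. Proof. by rewrite ltr0n. Qed.
Let Dt_gt0 t : 0 < D%:R ^+ t :> R. Proof. by rewrite exprn_gt0 // ltr0n. Qed.

Lemma hom_walkE t : (0 < t)%N -> hom t = D%:R ^+ t * \sum_x prob t x x.
Proof.
move=> t0; rewrite /hom hom_count_cycle //.
under eq_bigr => x _.
  rewrite (_ : prob t x x = walkE t x (fun s => (last x s == x)%:R * 1)); last first.
    by apply: eq_walkE => s _; rewrite mulr1.
  over.
rewrite (closed_walkE e D_gt0 (fun=> 1) t0) sumr_const.
by congr _%:R; apply: eq_card => s; rewrite inE.
Qed.

Lemma mon_walkE t : (0 < t)%N ->
  mon t = D%:R ^+ t * \sum_x walkE t x (fun s => (last x s == x)%:R * (uniq s)%:R).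
Proof.
move=> t0; rewrite /mon mon_count_cycle // (closed_walkE e D_gt0 (fun s => (uniq s)%:R) t0).
rewrite -natr_sum -big_mkcondr sum1_card.
by congr _%:R; apply: eq_card => s; rewrite inE.
Qed.

Lemma hom_sub_mon t : (0 < t)%N -> hom t - mon t =
  D%:R ^+ t * \sum_x walkE t x (fun s => (last x s == x)%:R * (~~ uniq s)%:R).
Proof.
move=> t0; rewrite hom_walkE // mon_walkE // -mulrBr; congr (_ * _).
apply/eqP; rewrite subr_eq -big_split; apply/eqP/eq_bigr => x _ /=.
rewrite -walkED; apply: eq_walkE => s _; by case: uniq; rewrite !(mulr0, mulr1, addr0, add0r).
Qed.

Section Transitive.
Variables (pi : nat -> R) (v : V).
Hypothesis piE : forall d x, prob d x x = pi d.

Lemma hom_pi t : (0 < t)%N -> hom t = D%:R ^+ t * (N * pi t).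
Proof.
move=> t0; rewrite hom_walkE //; congr (_ * _); under eq_bigr do rewrite piE.
by rewrite sumr_const mulr_natl.
Qed.

(** Meant for short walks: one factor [t] counts positions, the other bounds the number of gaps. *)
Lemma hom_sub_mon_le t (B : R) : (0 < t)%N -> 0 <= B ->
  (forall d, (0 < d < t)%N -> pi d * pi (t - d) <= B * pi t) ->
  hom t - mon t <= hom t * (t%:R ^+ 2 * B).
Proof.
move=> t0 B0 dB; rewrite hom_sub_mon // hom_pi // -mulrA ler_pM2l //.
apply: le_trans (collision_bound D_gt0 t piE) _; rewrite -mulrA ler_pM2l //.
have S_le : \sum_(1 <= d < t) pi d * pi (t - d) <= t%:R * (B * pi t).
  apply: (@le_trans _ _ (\sum_(1 <= d < t) B * pi t)).
    by rewrite big_nat_cond [leRHS]big_nat_cond; apply: ler_sum => d /andP[/dB].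
  rewrite sumr_const_nat -[leLHS]mulr_natl ler_wpM2r ?ler_nat ?leq_subr //.
  by rewrite mulr_ge0 // -(piE t v) prob_ge0.
apply: le_trans (ler_wpM2l _ S_le) _; first exact: ler0n.
by rewrite le_eqVlt; apply/orP; left; apply/eqP; ring.
Qed.

(** As [2 m <= t], one of [d] and [t - d] is at least [m], so its return probability is at most
    [2 / N <= 4 * pi t]; the other factor is summed, and the two cases give [2 W]. *)
Lemma hom_sub_mon_large t m (W : R) : (0 < t)%N -> (2 * m <= t)%N ->
  (forall d, (m <= d)%N -> (2 * N)^-1 <= pi d <= 2 / N) ->
  \sum_(1 <= d < t) pi d <= W ->
  hom t - mon t <= hom t * (8 * t%:R * W).
Proof.
move=> t0 mt mix sumW; have pi0 d : 0 <= pi d by rewrite -(piE d v) prob_ge0.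
rewrite hom_sub_mon // hom_pi // -mulrA ler_pM2l //.
apply: le_trans (collision_bound D_gt0 t piE) _; rewrite -mulrA ler_pM2l //.
have pit : N^-1 <= 2 * pi t.
  have /andP[h _] : (2 * N)^-1 <= pi t <= 2 / N by apply: mix; lia.
  by move: h; rewrite invfM; lra.
have term d : (0 < d < t)%N -> pi d * pi (t - d) <= 4 * pi t * (pi d + pi (t - d)%N).
  move=> dt; wlog dm : d dt / (m <= d)%N => [h|].
    have [md|md] := leqP m d; first exact: h.
    have := h (t - d)%N; rewrite subKn; last lia.
    rewrite mulrC [pi _ + _]addrC; apply; lia.
  have /andP[_ h] := mix d dm.
  rewrite mulrDr; apply: (@le_trans _ _ (4 * pi t * pi (t - d))); last by rewrite lerDr !mulr_ge0.
  by apply: ler_wpM2r => //; lra.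
have S_le : \sum_(1 <= d < t) pi d * pi (t - d) <= 4 * pi t * (2 * W).
  apply: (@le_trans _ _ (4 * pi t * (\sum_(1 <= d < t) pi d + \sum_(1 <= d < t) pi (t - d)))).
    rewrite -big_split mulr_sumr big_nat_cond [leRHS]big_nat_cond.
    by apply: ler_sum => d /andP[/term].
  rewrite ler_wpM2l ?mulr_ge0 // [X in _ + X]big_nat_rev /=.
  rewrite (_ : \sum_(1 <= d < t) pi (t - (1 + t - d.+1)) = \sum_(1 <= d < t) pi d); first lra.
  by apply: eq_big_nat => d dt; congr pi; lia.
apply: le_trans (ler_wpM2l _ S_le) _; first exact: ler0n.
by rewrite le_eqVlt; apply/orP; left; apply/eqP; ring.
Qed.

End Transitive.

(** Keep injectivity only for the first [T] steps. The remaining steps, at least [m] of them, close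
    the walk with probability at most [(1 + eta) / N] from wherever it stands. *)
Lemma mon_le t T m (eta q : R) : (T + m <= t)%N -> (0 < t)%N -> 0 <= q -> 0 <= eta ->
  (forall d x y, (m <= d)%N -> (1 - eta) / N <= prob d x y <= (1 + eta) / N) ->
  (forall x, walkE T x (fun s => (uniq s)%:R) <= q) ->
  mon t * (1 - eta) <= hom t * ((1 + eta) * q).
Proof.
move=> Tt t0 q0 eta0 mix Tq; rewrite mon_walkE // hom_walkE // -!mulrA ler_pM2l //.
have homlb : 1 - eta <= \sum_x prob t x x.
  apply: (@le_trans _ _ (\sum_(x : V) (1 - eta) / N)).
    by rewrite sumr_const -[leRHS]mulr_natr -/N divfK // gt_eqF.
  by apply: ler_sum => x _; have /andP[] : (1 - eta) / N <= prob t x x <= (1 + eta) / N by apply: mix; lia.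
have monub : \sum_x walkE t x (fun s => (last x s == x)%:R * (uniq s)%:R) <= (1 + eta) * q.
  apply: (@le_trans _ _ (\sum_(x : V) q * ((1 + eta) / N))); last first.
    rewrite sumr_const -[leLHS]mulr_natr -/N -mulrA divfK ?gt_eqF //; lra.
  apply: ler_sum => x _; have -> : t = (T + (t - T))%N by lia.
  rewrite walkE_add; apply: (@le_trans _ _ (walkE T x (fun s => (uniq s)%:R * ((1 + eta) / N)))).
    apply: le_walkE => s _.
    apply: (@le_trans _ _ ((uniq s)%:R * prob (t - T) (last x s) x)).
      rewrite mulrC -walkEZ; apply: le_walkE => s' _; rewrite last_cat cat_uniq.
      by rewrite ler_wpM2l //; case: (uniq s) => //=; case: (_ && _).
    rewrite ler_wpM2l //; have /andP[] : (1 - eta) / N <= prob (t - T) (last x s) x <= (1 + eta) / N.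
      by apply: mix; lia.
    by [].
  by rewrite walkEZ ler_wpM2r // divr_ge0 ?addr_ge0 // ltW.
have mon0 : 0 <= \sum_x walkE t x (fun s => (last x s == x)%:R * (uniq s)%:R).
  by apply: sumr_ge0 => x _; apply: walkE_ge0 => s; rewrite mulr_ge0.
have q1 : 0 <= (1 + eta) * q by rewrite mulr_ge0 // addr_ge0.
have [e1|e1] := leP 0 (1 - eta); last first.
  apply: (@le_trans _ _ 0); first by rewrite mulr_ge0_le0 // ltW.
  by rewrite mulr_ge0 //; apply: sumr_ge0 => x _; exact: prob_ge0.
by rewrite mulrC; apply: ler_pM.
Qed.
End Cycles.

(** * Counting and symmetry in the Johnson graph *)

(** [Y] is determined by its traces on [A] and [B], which can be chosen independently. *)
Lemma card_split_draws (T : finType) (A B : {set T}) a b : [disjoint A & B] ->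
  #|[set Y : {set T} | [&& Y \subset A :|: B, #|Y :&: A| == a & #|Y :&: B| == b]]|
  = ('C(#|A|, a) * 'C(#|B|, b))%N.
Proof.
move=> dAB; have AB0 : A :&: B = finset.set0 by apply: disjoint_setI0.
rewrite -!cards_draws -cardsX.
rewrite -(card_in_imset (f := fun Y : {set T} => (Y :&: A, Y :&: B))); last first.
  move=> Y Z; rewrite !inE => /and3P[/finset.setIidPl YE _ _] /and3P[/finset.setIidPl ZE _ _] [h1 h2].
  by rewrite -YE -ZE !finset.setIUr h1 h2.
apply: eq_card => -[P Q]; rewrite !inE /=; apply/imsetP/andP => [[Y]|].
  rewrite inE => /and3P[_ /eqP h1 /eqP h2] [-> ->].
  by rewrite !finset.subsetIr h1 h2 !eqxx.
move=> [/andP[PA /eqP Pa] /andP[QB /eqP Qb]]; exists (P :|: Q).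
  rewrite inE !finset.setIUl.
  have -> : Q :&: A = finset.set0.
    by apply/eqP; rewrite -finset.subset0 -AB0 finset.setIC finset.setIS.
  have -> : P :&: B = finset.set0 by apply/eqP; rewrite -finset.subset0 -AB0 finset.setSI.
  rewrite finset.setU0 finset.set0U (finset.setIidPl PA) (finset.setIidPl QB) Pa Qb !eqxx.
  by rewrite finset.setUSS.
rewrite !finset.setIUl.
have -> : Q :&: A = finset.set0.
  by apply/eqP; rewrite -finset.subset0 -AB0 finset.setIC finset.setIS.
have -> : P :&: B = finset.set0 by apply/eqP; rewrite -finset.subset0 -AB0 finset.setSI.
by rewrite finset.setU0 finset.set0U (finset.setIidPl PA) (finset.setIidPl QB).
Qed.

Lemma card_jvert_pred n r (P : pred {set 'I_n}) :
  #|[set y : jvert n r | P (val y)]| = #|[set Y : {set 'I_n} | (#|Y| == r) && P Y]|.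
Proof.
rewrite -(card_imset _ val_inj); apply: eq_card => Y; rewrite !inE.
apply/imsetP/andP => [[y]|[rY PY]].
  by rewrite inE => Py ->; rewrite (valP y).
by exists (Sub Y rY : jvert n r); rewrite ?inE SubK.
Qed.

Lemma card_jvert n r : #|{: jvert n r}| = 'C(n, r).
Proof.
rewrite -cardsT (_ : [set: jvert n r] = [set y : jvert n r | predT (val y)]); last first.
  by apply/setP => y; rewrite !inE.
rewrite card_jvert_pred -[in RHS](card_ord n) -card_draws.
by apply: eq_card => Y; rewrite !inE andbT.
Qed.

Lemma johnson_sym n r s : symmetric (johnson_rel n r s).
Proof. by move=> x y; rewrite /johnson_rel finset.setIC. Qed.

Lemma johnson_degree (n r s : nat) (x : jvert n r) : (s <= r)%N ->
  #|[set y | johnson_rel n r s x y]| = johnsonN1 n r s.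
Proof.
move=> sr; rewrite /johnson_rel /johnsonN1.
rewrite (card_jvert_pred r (fun Y => #|val x :&: Y| == s)) /=.
have /eqP := valP x; rewrite /=; move: (sval x) => X xr.
have dx : [disjoint X & ~: X] by rewrite -finset.setI_eq0 finset.setICr eqxx.
have cx : #|~: X| = (n - r)%N by rewrite cardsCs finset.setCK card_ord xr.
have := card_split_draws s (r - s)%N dx; rewrite xr cx => <-; apply: eq_card => Y; rewrite !inE.
rewrite finset.setUCr finset.subsetT /= finset.setIC.
have := cardsID (X) Y; rewrite finset.setDE => h.
apply/idP/idP => /andP[/eqP h1 /eqP h2]; apply/andP; split; apply/eqP.
- exact: h2.
- by rewrite -h1 -h h2 addKn.
- by rewrite -h h1 h2 subnKC.
exact: h1.
Qed.

Lemma bin_ub m n j : (m <= n)%N -> ('C(m, j) <= n ^ j)%N.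
Proof.
move=> mn; apply: (@leq_trans (m ^_ j)).
  by rewrite -bin_ffact leq_pmulr ?fact_gt0.
elim: j m mn => [//|j IH] [|m] mn //; rewrite ffactSS expnS leq_mul //; exact/IH/ltnW.
Qed.

Lemma bin_lb n m r j : (j <= r)%N -> (n <= 2 * (m - r))%N ->
  (n ^ j <= 2 ^ r * r`! * 'C(m, j))%N.
Proof.
move=> jr nm; apply: (@leq_trans (2 ^ r * m ^_ j)); last first.
  rewrite -mulnA leq_mul // -bin_ffact mulnC leq_mul //.
  by have := fact_gt0 r; rewrite (fact_split jr) muln_gt0 => /andP[_ ?]; rewrite leq_pmulr.
have ff : forall i, (i <= r)%N -> ((m - r) ^ i <= m ^_ i)%N.
  elim=> [//|i IH] ir; rewrite ffactnSr expnSr leq_mul ?IH //; lia.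
apply: (@leq_trans ((2 * (m - r)) ^ j)); first by case: (j) => // i; rewrite leq_exp2r.
by rewrite expnMn leq_mul ?ff // leq_pexp2l.
Qed.

(** Enumerate [A], then [B], then the rest, do the same for [A'] and [B'], and match equal
    positions. *)
Lemma exists_perm_disjoint (T : finType) (A B A' B' : {set T}) :
  [disjoint A & B] -> [disjoint A' & B'] -> #|A| = #|A'| -> #|B| = #|B'| ->
  exists s : {perm T}, s @: A = A' /\ s @: B = B'.
Proof.
move=> dAB dAB' cA cB.
pose L (A B : {set T}) := enum A ++ enum B ++ enum (~: (A :|: B)).
have uL (C E : {set T}) : [disjoint C & E] -> uniq (L C E).
  move=> dCE; rewrite !cat_uniq !enum_uniq /= andbT; apply/andP; split.
    apply/hasPn => x; rewrite mem_cat !mem_enum !inE negb_or => /orP[xE|/andP[] //].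
    by rewrite (disjointFl dCE xE).
  by apply/hasPn => x; rewrite !mem_enum !inE negb_or => /andP[].
have memL (C E : {set T}) x : x \in L C E.
  by rewrite !mem_cat !mem_enum !inE; case: (x \in C); case: (x \in E).
have sL (C E : {set T}) : [disjoint C & E] -> size (L C E) = #|T|.
  move=> dCE; rewrite -(card_uniqP (uL _ _ dCE)); apply: eq_card => x; by rewrite memL.
pose f x := nth x (L A' B') (index x (L A B)).
have idx x : (index x (L A B) < size (L A' B'))%N by rewrite sL // -(sL A B) // index_mem.
have finj : injective f.
  move=> x y; rewrite /f (set_nth_default y) // => /eqP.
  rewrite nth_uniq ?uL // => /eqP h.
  by rewrite -(nth_index x (memL A B x)) h (set_nth_default y) ?index_mem // nth_index.
exists (perm finj); split; apply/eqP; rewrite eqEcard card_imset ?cA ?cB ?leqnn ?andbT; try exact: perm_inj.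
  apply/fintype.subsetP => _ /imsetP[x xA ->]; rewrite permE /f /L index_cat mem_enum xA.
  have h : (index x (enum A) < size (enum A'))%N.
    by rewrite -cardE -cA cardE index_mem mem_enum.
  by rewrite nth_cat h -mem_enum mem_nth.
apply/fintype.subsetP => _ /imsetP[x xB ->]; rewrite permE /f /L index_cat mem_enum (disjointFl dAB xB).
rewrite index_cat mem_enum xB nth_cat -!cardE cA ltnNge leq_addr /= addKn.
have h : (index x (enum B) < size (enum B'))%N.
  by rewrite -cardE -cB cardE index_mem mem_enum.
by rewrite nth_cat h -mem_enum mem_nth.
Qed.

(** Permutations of the ground set act by automorphisms; they are transitive on vertices and on
    ordered pairs of disjoint vertices. *)
Lemma prob_johnson_disjoint (R : realFieldType) (n r s D d : nat) (x y z w : jvert n r) :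
  (val x == val y) && (val z == val w)
   || [disjoint val x & val y] && [disjoint val z & val w] ->
  prob R (johnson_rel n r s) D d x y = prob R (johnson_rel n r s) D d z w.
Proof.
have key (q : {perm 'I_n}) : val z = q @: val x -> val w = q @: val y ->
    prob R (johnson_rel n r s) D d x y = prob R (johnson_rel n r s) D d z w.
  have qr (u : jvert n r) : #|q @: val u| == r by rewrite card_imset ?(valP u) //; exact: perm_inj.
  pose phi (u : jvert n r) : jvert n r := Sub (q @: val u) (qr u).
  move=> zq wq; have -> : z = phi x by apply/val_inj; rewrite SubK.
  have -> : w = phi y by apply/val_inj; rewrite SubK.
  rewrite prob_morph //.
    apply: injF_bij => u v /(congr1 val); rewrite !SubK => /imset_inj uv.
    by apply/val_inj/uv; exact: perm_inj.
  move=> u v; rewrite /johnson_rel !SubK -imsetI; last by move=> ? ? _ _; exact: perm_inj.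
  by rewrite card_imset //; exact: perm_inj.
have cardv (u v : jvert n r) : #|val u| = #|val v| by rewrite (eqP (valP u)) (eqP (valP v)).
case/orP => /andP[].
  move=> /eqP xy /eqP zw.
  (* Equal pairs reduce to the disjoint case with an empty second set. *)
  have d0 (u : jvert n r) : [disjoint val u & (finset.set0 : {set 'I_n})].
    by rewrite -finset.setI_eq0 finset.setI0.
  have [q [qx _]] := exists_perm_disjoint (d0 x) (d0 z) (cardv x z) erefl.
  by apply: (key q); rewrite -?xy -?zw qx.
move=> dxy dzw; have [q [qx qy]] := exists_perm_disjoint dxy dzw (cardv x z) (cardv y w).
by apply: (key q).
Qed.

Lemma card_subsetU (T : finType) (A B Y : {set T}) : [disjoint A & B] ->
  Y \subset A :|: B -> #|Y| = (#|Y :&: A| + #|Y :&: B|)%N.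
Proof.
move=> dAB YAB; rewrite -(cardsID A Y); congr (_ + #|pred_of_set _|)%N.
apply/setP => i; rewrite !inE; have := fintype.subsetP YAB i; rewrite !inE.
have [iA|niA] := boolP (i \in A); first by rewrite (disjointFr dAB iA) andbF.
by case: (i \in Y) => //= ->.
Qed.

(** Choose [u] in [Z], inside [X] if the two sets meet. Then [s] points of [Z :\ u] and [r - s]
    points outside both sets form a neighbour of [Z] whose trace on [X] lies in [(Z :&: X) :\ u]. *)
Lemma johnson_away (n r s i : nat) (x z : jvert n r) : (s < r)%N ->
  (#|val z :&: val x| <= i.+1)%N ->
  ('C(n - 2 * r, r - s) <=
   #|[set y | johnson_rel n r s z y && (#|val y :&: val x| <= i)%N]|)%N.
Proof.
move=> sr zxi.
rewrite /johnson_rel (card_jvert_pred r (fun Y => (#|val z :&: Y| == s) && (#|Y :&: val x| <= i)%N)).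
have /eqP xr := valP x; have /eqP zr := valP z.
move: (val x) (val z) xr zr zxi => X Z xr zr zxi.
have [u uZ uX] : exists2 u, u \in Z & (u \in X) || (Z :&: X == finset.set0).
  have [ZX0|/set0Pn[u]] := eqVneq (Z :&: X) finset.set0.
    have /card_gt0P[u uZ] : (0 < #|Z|)%N by rewrite zr; lia.
    by exists u => //; rewrite orbT.
  by rewrite inE => /andP[uZ uX]; exists u; rewrite ?uX.
pose A := Z :\ u; pose B := ~: (Z :|: X).
have dAB : [disjoint A & B].
  rewrite -finset.setI_eq0; apply/eqP/setP => j; rewrite !inE.
  by case: (j \in Z); rewrite ?andbF.
have cA : #|A| = r.-1 by have := cardsD1 u Z; rewrite uZ zr => ->.
have cB : (n - 2 * r <= #|B|)%N.
  rewrite cardsCs finset.setCK card_ord leq_sub2l // cardsU zr xr mul2n -addnn leq_subr //.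
apply: (@leq_trans ('C(#|A|, s) * 'C(#|B|, r - s))).
  apply: (@leq_trans (1 * 'C(#|B|, r - s))); first by rewrite mul1n leq_bin2l.
  by rewrite leq_mul // bin_gt0 cA; lia.
rewrite -card_split_draws //; apply/subset_leq_card/fintype.subsetP => Y.
rewrite !inE => /and3P[YAB /eqP YA /eqP YB].
have -> : #|Y| = r by rewrite (card_subsetU dAB YAB) YA YB subnKC // ltnW.
have -> : Z :&: Y = Y :&: A.
  apply/setP => j; rewrite !inE; have := fintype.subsetP YAB j; rewrite !inE.
  by case: (j \in Y); rewrite ?andbF //= andbT; case: (j \in Z); rewrite ?andbT ?andbF ?orbF //= => ->.
rewrite YA !eqxx /=.
have YX : Y :&: X \subset (Z :&: X) :\ u.
  apply/fintype.subsetP => j; rewrite !inE => /andP[jY jX]; have := fintype.subsetP YAB j jY.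
  by rewrite !inE jX orbT /= orbF andbT.
apply: leq_trans (subset_leq_card YX) _.
case/orP: uX => [uX|/eqP ->]; last by rewrite finset.set0D cards0.
by move: zxi; rewrite (cardsD1 u (Z :&: X)) inE uZ uX add1n ltnS.
Qed.

(* Each of these triangles is a sunflower: the three sets share one [s]-subset. *)
Lemma johnson_common (n r s : nat) (x y : jvert n r) : (s < r)%N -> johnson_rel n r s x y ->
  ('C(n - 2 * r, r - s) <= #|[set z | johnson_rel n r s y z && johnson_rel n r s z x]|)%N.
Proof.
move=> sr; rewrite /johnson_rel (card_jvert_pred r (fun Z => (#|val y :&: Z| == s) && (#|Z :&: val x| == s))).
have /eqP xr := valP x; have /eqP yr := valP y.
move: (val x) (val y) xr yr => X Y xr yr /eqP XYs.
pose A := X :&: Y; pose B := ~: (X :|: Y).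
have dAB : [disjoint A & B].
  rewrite -finset.setI_eq0; apply/eqP/setP => j; rewrite !inE.
  by case: (j \in X); rewrite ?andbF.
have cB : (n - 2 * r <= #|B|)%N.
  rewrite cardsCs finset.setCK card_ord leq_sub2l // cardsU yr xr mul2n -addnn leq_subr //.
apply: (@leq_trans ('C(#|A|, s) * 'C(#|B|, r - s))).
  by rewrite XYs binn mul1n leq_bin2l.
rewrite -card_split_draws //; apply/subset_leq_card/fintype.subsetP => Z.
rewrite !inE => /and3P[ZAB /eqP ZA /eqP ZB].
have -> : #|Z| = r by rewrite (card_subsetU dAB ZAB) ZA ZB subnKC // ltnW.
have -> : Y :&: Z = Z :&: A.
  apply/setP => j; rewrite !inE; have := fintype.subsetP ZAB j; rewrite !inE.
  by case: (j \in Z); rewrite ?andbF //= ?andbT; case: (j \in X); case: (j \in Y) => //= /(_ isT).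
have -> : Z :&: X = Z :&: A.
  apply/setP => j; rewrite !inE; have := fintype.subsetP ZAB j; rewrite !inE.
  by case: (j \in Z); rewrite ?andbF //= ?andbT; case: (j \in X); case: (j \in Y) => //= /(_ isT).
by rewrite ZA !eqxx.
Qed.

Lemma johnsonN1_ub n r s : (s < r)%N -> (johnsonN1 n r s <= r ^ r * n ^ (r - s))%N.
Proof.
move=> sr; rewrite /johnsonN1 leq_mul ?bin_ub ?leq_subr //.
by apply: leq_trans (bin_ub s (leqnn r)) _; rewrite leq_pexp2l //; lia.
Qed.

(** Group [y] by the size [i > s] of the intersection: each class is counted by the degree with [i]
    in place of [s], at least one power of [n] below the order [n ^ (r - s)] of the degree
    itself. *)
Lemma johnson_row (n r s : nat) (x : jvert n r) : (s < r)%N -> (0 < n)%N ->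
  (\sum_(y : jvert n r | (s < #|val x :&: val y|)%N) 'C(#|val x :&: val y|, s)
   <= r.+1 * (r ^ r * (r ^ r * n ^ (r - s.+1))))%N.
Proof.
move=> sr n0.
have xyr (y : jvert n r) : (#|val x :&: val y| < r.+1)%N.
  have /eqP xr := valP x; rewrite ltnS -[leqRHS]xr; exact/subset_leq_card/finset.subsetIl.
rewrite (partition_big (fun y => Ordinal (xyr y)) xpredT) //=.
apply: (@leq_trans (\sum_(i < r.+1) r ^ r * (r ^ r * n ^ (r - s.+1)))); last first.
  by rewrite sum_nat_const card_ord.
apply: leq_sum => i _.
have [si|si] := ltnP s i; last first.
  rewrite big_pred0 // => y; apply/negbTE; rewrite negb_and -leqNgt.
  case: eqP => [/(congr1 val) /= ->|]; rewrite ?si ?orbT //.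
apply: (@leq_trans (\sum_(y : jvert n r | johnson_rel n r i x y) r ^ r)).
  rewrite [leqRHS]big_mkcond [leqLHS]big_mkcond; apply: leq_sum => y _.
  case: ifP => // /andP[_ /eqP /(congr1 val) /= xyi]; rewrite /johnson_rel xyi eqxx.
  apply: leq_trans (bin_ub s (leqnn _)) _; apply: (@leq_trans (r ^ s)); last first.
    by rewrite leq_pexp2l; lia.
  by case: (s) => // s'; rewrite leq_exp2r // -ltnS.
rewrite sum_nat_const mulnC leq_mul //.
have -> : #|[pred y | johnson_rel n r i x y]| = johnsonN1 n r i.
  rewrite -(johnson_degree x); last by rewrite -ltnS.
  by apply: eq_card => y; rewrite !inE.
rewrite /johnsonN1 leq_mul //.
  apply: leq_trans (bin_ub i (leqnn r)) _; rewrite leq_pexp2l //; first by lia.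
  by rewrite -ltnS.
apply: leq_trans (bin_ub _ (leq_subr r n)) _.
by rewrite leq_pexp2l // leq_sub2l.
Qed.

(* The adjacency matrix is [W^T W], where [W] is the inclusion matrix of
   [s]-subsets in [r]-subsets, minus a nonnegative matrix of small row sums. *)
Lemma johnson_psd (R : realFieldType) (n r s : nat) (c : R) (f : jvert n r -> R) :
  (0 < johnsonN1 n r s)%N ->
  (forall x : jvert n r,
    (\sum_(y : jvert n r | (s < #|val x :&: val y|)%N) 'C(#|val x :&: val y|, s))%:R
    <= c * (johnsonN1 n r s)%:R) ->
  0 <= (\sum_x \sum_y f x * step R (johnson_rel n r s) (johnsonN1 n r s) x y * f y)
       + c * \sum_x f x ^+ 2.
Proof.
set D := johnsonN1 n r s => D_gt0 row.
have D0 : 0 < D%:R :> R by rewrite ltr0n.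
pose h (x y : jvert n r) : R :=
  if (s < #|val x :&: val y|)%N then 'C(#|val x :&: val y|, s)%:R else 0.
have hsym x y : h x y = h y x by rewrite /h finset.setIC.
have h0 x y : 0 <= h x y by rewrite /h; case: ifP.
rewrite -(pmulr_rge0 _ D0) mulrDr.
have -> : D%:R * (\sum_x \sum_y f x * step R (johnson_rel n r s) D x y * f y)
   = \sum_(x : jvert n r) \sum_(y : jvert n r) f x * f y * 'C(#|val x :&: val y|, s)%:R
     - \sum_x \sum_y f x * f y * h x y.
  rewrite -sumrB mulr_sumr; apply: eq_bigr => x _.
  rewrite -sumrB mulr_sumr; apply: eq_bigr => y _.
  rewrite -mulrBr; have -> : 'C(#|val x :&: val y|, s)%:R - h x y = (johnson_rel n r s x y)%:R.
    rewrite /h /johnson_rel; case: ltngtP => [lt|lt|->]; rewrite ?subrr ?binn ?subr0 //.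
    by rewrite bin_small.
  by rewrite /step; field; rewrite gt_eqF.
have psd : 0 <= \sum_(x : jvert n r) \sum_(y : jvert n r) f x * f y * 'C(#|val x :&: val y|, s)%:R.
  have -> : \sum_(x : jvert n r) \sum_(y : jvert n r) f x * f y * 'C(#|val x :&: val y|, s)%:R
     = \sum_(U : {set 'I_n} | #|U| == s) (\sum_(x : jvert n r | U \subset val x) f x) ^+ 2.
    transitivity (\sum_(x : jvert n r) \sum_(y : jvert n r) \sum_(U : {set 'I_n} | #|U| == s)
        (U \subset val x)%:R * f x * ((U \subset val y)%:R * f y)).
      apply: eq_bigr => x _; apply: eq_bigr => y _.
      rewrite -cards_draws -sum1_card natr_sum mulr_sumr big_mkcond [RHS]big_mkcond.
      apply: eq_bigr => U _; rewrite inE finset.subsetI.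
      by case: (_ == s); case: (_ \subset _); case: (_ \subset _); rewrite /= ?mul1r ?mulr1 ?mul0r ?mulr0.
    under eq_bigr do rewrite exchange_big /=.
    rewrite exchange_big /=; apply: eq_bigr => U _.
    have -> : \sum_(x : jvert n r | U \subset val x) f x = \sum_(x : jvert n r) (U \subset val x)%:R * f x.
      rewrite big_mkcond; apply: eq_bigr => x _.
      by case: (_ \subset _); rewrite ?mul1r ?mul0r.
    by rewrite expr2 mulr_suml; apply: eq_bigr => x _; rewrite mulr_sumr.
  by apply: sumr_ge0 => U _; exact: sqr_ge0.
have hub : \sum_x \sum_y f x * f y * h x y <= D%:R * (c * \sum_x f x ^+ 2).
  apply: (@le_trans _ _ (\sum_x f x ^+ 2 * \sum_y h x y)); last first.
    rewrite mulrA mulrC mulr_suml; apply: ler_sum => x _; rewrite ler_wpM2l ?sqr_ge0 //.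
    rewrite mulrC; apply: le_trans (row x); rewrite natr_sum [leRHS]big_mkcond; exact: ler_sum.
  apply: (@le_trans _ _ (\sum_x \sum_y (f x ^+ 2 / 2 * h x y + f y ^+ 2 / 2 * h x y))).
    apply: ler_sum => x _; apply: ler_sum => y _; rewrite -mulrDl ler_wpM2r //.
    have := sqr_ge0 (f x - f y); rewrite !expr2; lra.
  under eq_bigr do rewrite big_split /=; rewrite big_split /= [X in _ + X]exchange_big /=.
  rewrite -big_split; apply: ler_sum => x _ /=; rewrite -mulr_sumr.
  under [X in _ + X]eq_bigr do rewrite hsym.
  by rewrite -mulr_sumr; lra.
lra.
Qed.

(* [n ^ j <= bin_cst r * 'C(n - 2 * r, j)] for [j <= r] and [6 * r <= n], and
   [N1 <= deg_cst r * n ^ (r - s)]; the second summand of [n_min] bounds the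
   eigenvalues of the walk from below by [- gamma]. *)
Definition bin_cst (r : nat) : nat := (2 ^ r * r`!)%N.
Definition deg_cst (r : nat) : nat := (r ^ r)%N.
Definition n_min (r : nat) : nat := (6 * r + r.+1 * deg_cst r ^ 3 * bin_cst r ^ 2)%N.

(** Time budget: a quarter of [t] to build the visited set, at most another quarter for blocks of
    length [2 * r], and [m <= t / 2] steps to close up. The second bound is the budget for the
    backtracking argument. *)
Lemma split_time t r m : (0 < r)%N -> (2 * m <= t)%N -> (8 * r + 8 <= t)%N ->
  [/\ (t %/ 4 + t %/ (8 * r) * (2 * r) + m <= t)%N, ((t %/ 4).+2 + m <= t)%N,
      (t <= 8 * (t %/ 4))%N & (t <= 16 * r * (t %/ (8 * r)))%N].
Proof.
move=> r0 mt rt; split; [|lia|lia|].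
  have := leq_trunc_div t (8 * r).
  by rewrite (_ : t %/ (8 * r) * (8 * r) = 4 * (t %/ (8 * r) * (2 * r)))%N; [lia|ring].
have r8 : (0 < 8 * r)%N by lia.
have j1 : (0 < t %/ (8 * r))%N by rewrite divn_gt0; lia.
apply: leq_trans (ltnW (ltn_ceil t r8)) _; move: (t %/ (8 * r))%N j1 => j j1.
by rewrite (_ : 16 * r * j = (j + j) * (8 * r))%N ?leq_mul //; [lia|ring].
Qed.

Lemma bin_cst_gt0 r : (0 < bin_cst r)%N.
Proof. by rewrite muln_gt0 expn_gt0 fact_gt0. Qed.

Lemma deg_cst_gt0 r : (0 < deg_cst r)%N.
Proof. by rewrite expn_gt0; case: r. Qed.

(** * Constants and sizes for large [n] *)

Section Constants.
Variables (R : realFieldType) (r : nat).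

Definition gamma : R := (deg_cst r * bin_cst r)%:R^-1.
(** Doeblin constant for [2 * r] steps: [gamma ^ r] for each half, and [1 / bin_cst r] for the
    proportion of vertices disjoint from both ends. *)
Definition delta : R := gamma ^+ (2 * r) / (bin_cst r)%:R.

Let cst_gt0 : (0 < deg_cst r * bin_cst r)%N.
Proof. by rewrite muln_gt0 deg_cst_gt0 bin_cst_gt0. Qed.

Lemma gamma_gt0 : 0 < gamma.
Proof. by rewrite invr_gt0 ltr0n. Qed.

Lemma gamma_le1 : gamma <= 1.
Proof. by rewrite invf_le1 ?ltr0n // ler1n. Qed.

Lemma delta_gt0 : 0 < delta.
Proof. by rewrite divr_gt0 ?ltr0n ?bin_cst_gt0 // exprn_gt0 // gamma_gt0. Qed.

Lemma delta_le1 : delta <= 1.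
Proof.
rewrite ler_pdivrMr ?ltr0n ?bin_cst_gt0 // mul1r; apply: (@le_trans _ _ 1); last first.
  by rewrite ler1n bin_cst_gt0.
by rewrite exprn_ile1 ?gamma_le1 // ltW // gamma_gt0.
Qed.

End Constants.

Section JohnsonSizes.
Variables (n r s : nat).
Hypothesis sr : (s < r)%N.
Hypothesis n_large : (n_min r <= n)%N.

Let K := bin_cst r.
Let r_gt0 : (0 < r)%N. Proof. exact: leq_ltn_trans sr. Qed.
Let n6 : (6 * r <= n)%N. Proof. by apply: leq_trans n_large; exact: leq_addr. Qed.
Let n_gt0 : (0 < n)%N. Proof. by apply: leq_trans n6; rewrite muln_gt0. Qed.

Lemma johnson_bin_lb j : (j <= r)%N -> (n ^ j <= K * 'C(n - 2 * r, j))%N.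
Proof. by move=> jr; apply: bin_lb jr _; lia. Qed.

Lemma johnson_deg_lb : (n ^ (r - s) <= K * johnsonN1 n r s)%N.
Proof.
apply: leq_trans (johnson_bin_lb (leq_subr s r)) _; rewrite leq_mul //.
apply: (@leq_trans (1 * 'C(n - r, r - s))); first by rewrite mul1n leq_bin2l //; lia.
by rewrite leq_mul // bin_gt0 ltnW.
Qed.

Lemma johnson_n_le_deg : (n <= K * johnsonN1 n r s)%N.
Proof.
by apply: leq_trans johnson_deg_lb; rewrite -{1}(expn1 n) leq_pexp2l // subn_gt0.
Qed.

Lemma johnson_deg_gt0 : (0 < johnsonN1 n r s)%N.
Proof.
have : (0 < K * johnsonN1 n r s)%N by apply: leq_trans johnson_n_le_deg.
by rewrite muln_gt0 => /andP[].
Qed.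

Lemma johnson_card_ub : (#|{: jvert n r}| <= n ^ r)%N.
Proof. by rewrite card_jvert bin_ub. Qed.

Lemma johnson_n_le_card : (n <= K * #|{: jvert n r}|)%N.
Proof.
rewrite card_jvert; apply: (@leq_trans (n ^ r)); first by rewrite -{1}(expn1 n) leq_pexp2l.
by apply: leq_trans (johnson_bin_lb (leqnn r)) _; rewrite leq_mul // leq_bin2l // leq_subr.
Qed.

Lemma johnson_card_gt0 : (0 < #|{: jvert n r}|)%N.
Proof.
have : (0 < K * #|{: jvert n r}|)%N by apply: leq_trans johnson_n_le_card.
by rewrite muln_gt0 => /andP[].
Qed.

End JohnsonSizes.

(** * The walk on the Johnson graph *)

Section Johnson.
Variables (R : realFieldType) (n r s : nat).
Hypothesis sr : (s < r)%N.
Hypothesis n_large : (n_min r <= n)%N.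

Let V : finType := jvert n r.
Let e : rel V := johnson_rel n r s.
Let D := johnsonN1 n r s.
Let K := bin_cst r.
Let Q := deg_cst r.
Local Notation N := (#|V|%:R : R).
Local Notation p := (prob R e D).
Local Notation gamma := (gamma R r).
Local Notation delta := (delta R r).
Local Notation gamma_gt0 := (gamma_gt0 R r).
Local Notation gamma_le1 := (gamma_le1 R r).
Local Notation delta_gt0 := (delta_gt0 R r).
Local Notation delta_le1 := (delta_le1 R r).

Let K_gt0 : (0 < K)%N := bin_cst_gt0 r.
Let QK_gt0 : 0 < (Q * K)%:R :> R.
Proof. by rewrite ltr0n muln_gt0 deg_cst_gt0 bin_cst_gt0. Qed.
Let r_gt0 : (0 < r)%N. Proof. exact: leq_ltn_trans sr. Qed.
Let r2_gt0 : (0 < 2 * r)%N. Proof. by rewrite muln_gt0. Qed.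
Let n_gt0 : (0 < n)%N.
Proof. by apply: leq_trans n_large; rewrite addn_gt0 muln_gt0 r_gt0. Qed.
Let D_gt0 : (0 < D)%N := johnson_deg_gt0 sr n_large.
Let V_gt0 : (0 < #|V|)%N := johnson_card_gt0 sr n_large.
Let esym : symmetric e. Proof. exact: johnson_sym. Qed.
Let ereg x : #|[set y | e x y]| = D. Proof. by apply: johnson_degree; exact: ltnW. Qed.
Let DR_gt0 : 0 < D%:R :> R. Proof. by rewrite ltr0n. Qed.
Let N_gt0 : 0 < N. Proof. by rewrite ltr0n. Qed.
Let KR_gt0 : 0 < K%:R :> R. Proof. by rewrite ltr0n. Qed.

(** Turns the counts of [johnson_away] and [johnson_common] into one-step probabilities of at least
    [gamma]. *)
Lemma gamma_deg : gamma * D%:R <= 'C(n - 2 * r, r - s)%:R.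
Proof.
rewrite mulrC ler_pdivrMr // -natrM ler_nat.
apply: leq_trans (johnsonN1_ub n sr) _; rewrite -/Q mulnCA leq_mul // mulnC.
by rewrite (johnson_bin_lb sr n_large) // leq_subr.
Qed.

Lemma step_count (P : pred V) z :
  \sum_(y | P y) step R e D z y = #|[set y | e z y && P y]|%:R / D%:R.
Proof.
rewrite /step -mulr_suml -natr_sum; congr (_%:R / _).
rewrite -sum1_card big_mkcond [RHS]big_mkcond; apply: eq_bigr => y _.
by rewrite inE; case: (P y); rewrite ?andbF ?andbT //; case: e.
Qed.

(** With probability at least [gamma], a step lowers by one the bound on the intersection with
    [x]. *)
Lemma away_prob (x z : V) j : (#|val z :&: val x| <= j)%N ->
  gamma ^+ j <= \sum_(y : V | [disjoint val x & val y]) p j z y.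
Proof.
elim: j z => [|j IH] z zx.
  rewrite expr0 (bigD1 z) /=; last first.
    by rewrite -finset.setI_eq0 finset.setIC -cards_eq0 -leqn0.
  by rewrite prob0 eqxx lerDl; apply: sumr_ge0 => y _; exact: prob_ge0.
under eq_bigr do rewrite probS; rewrite exchange_big /=.
under eq_bigr do rewrite -mulr_sumr.
apply: (@le_trans _ _ (\sum_(y : V | (#|val y :&: val x| <= j)%N) step R e D z y * gamma ^+ j)).
  rewrite -mulr_suml exprS ler_wpM2r ?exprn_ge0 ?(ltW gamma_gt0) //.
  rewrite (step_count (fun y : V => (#|val y :&: val x| <= j)%N)) ler_pdivlMr //.
  by apply: le_trans gamma_deg _; rewrite ler_nat johnson_away.
rewrite big_mkcond; apply: ler_sum => y _; case: ifP => yx.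
  by rewrite ler_wpM2l ?step_ge0 // IH.
by rewrite mulr_ge0 ?step_ge0 //; apply: sumr_ge0 => ? _; exact: prob_ge0.
Qed.

(** The mass [gamma ^ r] that has moved off [x] is spread evenly, by symmetry, over at most [N]
    vertices. *)
Lemma prob_disjoint_lb (x y : V) : [disjoint val x & val y] -> gamma ^+ r / N <= p r x y.
Proof.
move=> dxy; rewrite ler_pdivrMr //; have := @away_prob x x r; rewrite finset.setIid.
have /eqP -> := valP x; move=> /(_ (leqnn r)) h; apply: le_trans h _.
apply: (@le_trans _ _ (\sum_(z : V | [disjoint val x & val z]) p r x y)).
  apply: ler_sum => z dxz; rewrite le_eqVlt; apply/orP; left; apply/eqP.
  by apply: prob_johnson_disjoint; rewrite dxz dxy orbT.
rewrite sumr_const -[leLHS]mulr_natr ler_wpM2l ?prob_ge0 // ler_nat max_card //.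
Qed.

(* Half-way, the walk is at a vertex disjoint from both [x] and [y]; by symmetry
   it is equally likely to be at any vertex disjoint from [x]. *)
Lemma johnson_doeblin (x y : V) : delta / N <= p (2 * r) x y.
Proof.
rewrite mul2n -addnn probD.
pose W : {set V} := [set z : V | [disjoint val x & val z] && [disjoint val y & val z]].
apply: (@le_trans _ _ (\sum_(z in W) (gamma ^+ r / N) ^+ 2)).
  have cW : (#|V| <= K * #|W|)%N.
    apply: leq_trans (johnson_card_ub n r) _.
    apply: leq_trans (johnson_bin_lb sr n_large (leqnn r)) _; rewrite leq_mul //.
    rewrite /W (card_jvert_pred r (fun Z => [disjoint val x & Z] && [disjoint val y & Z])).
    have /eqP xr := valP x; have /eqP yr := valP y.
    apply: (@leq_trans 'C(#|~: (val x :|: val y)|, r)).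
      by rewrite leq_bin2l // cardsCs finset.setCK card_ord leq_sub2l // cardsU yr xr mul2n -addnn leq_subr.
    rewrite -cards_draws; apply/subset_leq_card/fintype.subsetP => Z.
    rewrite !inE finset.setCU finset.subsetI -!finset.disjoints_subset ![[disjoint Z & _]]disjoint_sym.
    by move=> /andP[-> ->].
  rewrite sumr_const -[leRHS]mulr_natr.
  have -> : (gamma ^+ r / N) ^+ 2 * #|W|%:R = (gamma ^+ (2 * r) / N) * (#|W|%:R / N).
    by rewrite mulnC exprM; field; rewrite gt_eqF.
  rewrite /delta mulrAC ler_wpM2l ?mulr_ge0 ?invr_ge0 ?exprn_ge0 ?(ltW gamma_gt0) ?ler0n //.
  by rewrite ler_pdivlMr // mulrC ler_pdivrMr // -natrM ler_nat mulnC.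
rewrite [leRHS](bigID (mem W)) /= -[leLHS]addr0 lerD //; last first.
  by apply: sumr_ge0 => z _; rewrite mulr_ge0 ?prob_ge0.
apply: ler_sum => z; rewrite inE => /andP[dxz dyz].
have lb0 : 0 <= gamma ^+ r / N by rewrite divr_ge0 ?exprn_ge0 ?(ltW gamma_gt0) ?ler0n.
rewrite expr2 [p r z y]prob_sym //; apply: ler_pM => //; exact: prob_disjoint_lb.
Qed.

Lemma johnson_transitive d (x y : V) : p d x x = p d y y.
Proof. by apply: prob_johnson_disjoint; rewrite !eqxx. Qed.

Lemma johnson_prob1 (x : V) : p 1 x x = 0.
Proof.
rewrite prob1 /step (_ : e x x = false) ?mul0r // /e /johnson_rel finset.setIid.
by have /eqP -> := valP x; apply/negbTE; rewrite gtn_eqF.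
Qed.

(** After any first step, the second reaches a common neighbour with probability at least [gamma],
    and the third closes the triangle with probability [1 / D]. *)
Lemma johnson_prob3 (x : V) : gamma / D%:R <= p 3 x x.
Proof.
have -> : gamma / D%:R = \sum_y step R e D x y * (gamma / D%:R).
  by rewrite -mulr_suml (step_sum R ereg D_gt0) mul1r.
rewrite probS.
apply: ler_sum => y _; have [xy|/negbTE nxy] := boolP (e x y); last by rewrite /step nxy !mul0r.
rewrite ler_wpM2l ?step_ge0 //.
have -> : p 2 y x = \sum_z step R e D y z * ((e z x)%:R / D%:R).
  by rewrite probS; apply: eq_bigr => z _; rewrite prob1.
apply: (@le_trans _ _ ((\sum_(z | e z x) step R e D y z) / D%:R)).
  rewrite ler_pM2r ?invr_gt0 // (step_count (fun z => e z x)) ler_pdivlMr //.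
  by apply: le_trans gamma_deg _; rewrite ler_nat johnson_common.
rewrite mulr_suml big_mkcond; apply: ler_sum => z _.
by case: (e z x); rewrite ?mul1r // mul0r mulr0.
Qed.

Lemma johnson_quad (f : V -> R) :
  0 <= (\sum_x \sum_y f x * step R e D x y * f y) + gamma * \sum_x f x ^+ 2.
Proof.
apply: johnson_psd => // x; rewrite mulrC ler_pdivlMr // -natrM ler_nat.
apply: (@leq_trans (r.+1 * (Q * (Q * n ^ (r - s.+1))) * (Q * K))).
  by rewrite leq_mul // johnson_row.
rewrite -(leq_pmul2r K_gt0) [leqRHS]mulnC; apply: leq_trans (johnson_deg_lb sr n_large).
have -> : (r - s = (r - s.+1).+1)%N by lia.
rewrite expnS; apply: (@leq_trans ((r.+1 * Q ^ 3 * K ^ 2) * n ^ (r - s.+1))).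
  rewrite leq_eqVlt; apply/orP; left; apply/eqP; ring.
by rewrite leq_mul //; apply: leq_trans n_large; exact: leq_addl.
Qed.

Local Notation hom t := ((hom_count (cycle_rel t) e)%:R : R).
Local Notation mon t := ((mon_count (cycle_rel t) e)%:R : R).

Lemma johnson_pi_cubic (x0 : V) j :
  gamma ^+ 2 * (p (j + j).+3 x0 x0 - gamma * p (j + j).+2 x0 x0)
  <= p (j + j).+4.+1 x0 x0 - gamma * p (j + j).+4 x0 x0.
Proof.
apply: (@pi_cubic _ _ _ _ esym (fun d => p d x0 x0) x0) => [d x|f].
  exact: johnson_transitive.
exact: johnson_quad.
Qed.

Lemma johnson_pi3 (x0 : V) : gamma * p 2 x0 x0 <= p 3 x0 x0.
Proof. by rewrite prob2_diag ?johnson_prob3. Qed.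

Lemma johnson_pi_gt0 (x0 : V) t : (1 < t)%N -> 0 < p t x0 x0.
Proof.
apply: (@moment_gt0 _ (fun t => p t x0 x0) gamma gamma_gt0) => [||j|].
- exact: gamma_le1.
- move=> j; rewrite -addnn; apply: (@pi_even_gt0 _ _ _ _ esym ereg D_gt0 (fun d => p d x0 x0) x0).
  by move=> d x; exact: johnson_transitive.
- exact: johnson_pi_cubic.
exact: johnson_pi3.
Qed.

Lemma johnson_pi_prod (x0 : V) d t : (0 < d < t)%N ->
  gamma ^+ 4 * (p d x0 x0 * p (t - d) x0 x0) <= D%:R^-1 * p t x0 x0.
Proof.
rewrite -(prob2_diag R esym ereg D_gt0 x0).
have tr d' (x : V) : p d' x x = p d' x0 x0 by exact: johnson_transitive.
apply: (@moment_prod_le _ (fun t => p t x0 x0) gamma gamma_gt0).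
- exact: gamma_le1.
- by move=> d'; exact: prob_ge0.
- by move=> j; rewrite -addnn; apply: (@pi_even_gt0 _ _ _ _ esym ereg D_gt0 (fun d => p d x0 x0) x0).
- exact: johnson_prob1.
- exact: (@pi_logconvex _ _ _ _ esym ereg D_gt0 (fun d => p d x0 x0) x0).
- exact: (@pi_odd_le _ _ _ _ esym ereg D_gt0 (fun d => p d x0 x0) x0).
- exact: johnson_pi_cubic.
exact: johnson_pi3.
Qed.

Lemma johnson_hom_gt0 t : (1 < t)%N -> 0 < hom t.
Proof.
move=> t1; have /card_gt0P[x0 _] := V_gt0.
have tr d' (x : V) : p d' x x = p d' x0 x0 by exact: johnson_transitive.
rewrite (hom_pi esym D_gt0 tr) ?(ltnW t1) //.
by rewrite mulr_gt0 ?exprn_gt0 // mulr_gt0 // johnson_pi_gt0.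
Qed.

(** * Quantitative bounds in both directions at a fixed [n] *)

Section Mixing.
Variables (J : nat) (eta : R).
Hypothesis eta_ge0 : 0 <= eta.
Hypothesis mixed : (1 - delta) ^+ J * N <= eta.
(** The additional step keeps the remainder positive for [prob_ub]. *)
Let m := (J * (2 * r)).+1.

Lemma johnson_mix d (x y : V) : (m <= d)%N ->
  (1 - eta) / N <= p d x y <= (1 + eta) / N.
Proof.
move=> md; have -> : d = (J * (2 * r) + (d - m).+1)%N by rewrite /m in md *; lia.
have rho0 : 0 <= (1 - delta) ^+ J by rewrite exprn_ge0 // subr_ge0 delta_le1.
have N1 : 1 <= N by rewrite ler1n.
have D1 : 1 <= D%:R :> R by rewrite ler1n.
apply/andP; split.
  apply: le_trans (prob_lb esym ereg D_gt0 V_gt0 johnson_doeblin J _ x y).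
  rewrite ler_pM2r ?invr_gt0 // lerD2l lerN2; apply: le_trans mixed.
  by rewrite ler_peMr.
apply: le_trans (prob_ub esym ereg D_gt0 V_gt0 johnson_doeblin J x y (ltn0Sn _)) _.
rewrite mulrDl mul1r lerD2l ler_pdivlMr //.
by apply: le_trans mixed; rewrite ler_pM2r // ler_piMr // invf_le1.
Qed.

(** Two regimes under one bound: for [t >= 2 m] mixing and [return_sum] give the last two terms; for
    [t < 2 m] the product bound gives [t ^ 2 / D <= 4 m ^ 2 / D], the first term. *)
Lemma johnson_sufficient t : (1 < t)%N -> eta <= 2^-1 ->
  hom t - mon t <= hom t * ((4 / gamma ^+ 4 + 16 * r%:R / delta + 8) *
    (m%:R ^+ 2 / D%:R + t%:R / D%:R + t%:R ^+ 2 / N)).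
Proof.
move=> t1 eta2; have /card_gt0P[x0 _] := V_gt0.
have tr d' (x : V) : p d' x x = p d' x0 x0 by exact: johnson_transitive.
have g4 : 0 < gamma ^+ 4 by rewrite exprn_gt0 ?gamma_gt0.
have a0 : 0 <= m%:R ^+ 2 / D%:R :> R by rewrite divr_ge0 ?exprn_ge0.
have b0 : 0 <= t%:R / D%:R :> R by rewrite divr_ge0.
have c0 : 0 <= t%:R ^+ 2 / N by rewrite divr_ge0 ?exprn_ge0.
have gi0 : 0 <= 4 / gamma ^+ 4 by apply: divr_ge0; [exact: ler0n|exact: ltW].
have t0 : (0 < t)%N := ltnW t1.
have di0 : 0 <= 16 * r%:R / delta.
  by apply: divr_ge0; [rewrite mulr_ge0|exact/ltW/delta_gt0].
have [mt|tm] := leqP (2 * m) t.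
  have mix d : (m <= d)%N -> (2 * N)^-1 <= p d x0 x0 <= 2 / N.
    move=> md; have /andP[lb ub] := johnson_mix x0 x0 md; apply/andP; split.
      by apply: le_trans lb; rewrite invfM ler_pM2r ?invr_gt0 //; lra.
    by apply: le_trans ub _; rewrite ler_pM2r ?invr_gt0 //; lra.
  have ret := return_sum esym ereg D_gt0 r2_gt0 delta_gt0 delta_le1 V_gt0 johnson_doeblin t x0.
  have h := @hom_sub_mon_large R V e D esym D_gt0 V_gt0 (fun d => p d x0 x0) x0 tr t m _ t0 mt mix ret.
  apply: le_trans h _.
  rewrite ler_wpM2l // natrM.
  have -> : 8 * t%:R * (t%:R / N + 2 * r%:R / delta / D%:R) =
     8 * (t%:R ^+ 2 / N) + 16 * r%:R / delta * (t%:R / D%:R) by ring.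
  move: a0 b0 c0 gi0 di0; move: (_ / _) (_ / _) (_ / _) (_ / _) (_ / _) => *; nra.
have B0 : 0 <= gamma ^- 4 / D%:R by rewrite divr_ge0 // invr_ge0 ltW.
have prod d : (0 < d < t)%N -> p d x0 x0 * p (t - d) x0 x0 <= gamma ^- 4 / D%:R * p t x0 x0.
  move=> dt; rewrite -mulrA ler_pdivlMl //; exact: johnson_pi_prod.
have h := @hom_sub_mon_le R V e D esym D_gt0 V_gt0 (fun d => p d x0 x0) x0 tr t _ t0 B0 prod.
apply: le_trans h _.
rewrite ler_wpM2l //.
apply: (@le_trans _ _ (4 / gamma ^+ 4 * (m%:R ^+ 2 / D%:R))).
  have tm2 : t%:R ^+ 2 <= 4 * m%:R ^+ 2 :> R.
    have : t%:R <= 2 * m%:R :> R by rewrite -natrM ler_nat ltnW.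
    have : 0 <= t%:R :> R by []. 
    rewrite !expr2; nra.
  have -> : 4 / gamma ^+ 4 * (m%:R ^+ 2 / D%:R) = 4 * m%:R ^+ 2 * (gamma ^- 4 / D%:R) by ring.
  by rewrite ler_wpM2r // divr_ge0 // invr_ge0 ltW.
move: a0 b0 c0 gi0 di0; move: (_ / _) (_ / _) (_ / _) (_ / _) (_ / _) => *; nra.
Qed.

(** A large [t ^ 2 / N] calls for the birthday bound, a large [t / D] for backtracking. Either way
    an initial stretch is injective with probability at most [1 / (1 + beta)], and [mon_le]
    transfers this to closed walks. *)
Lemma johnson_necessary t (eps : R) : 0 < eps <= 1 -> (2 * m <= t)%N -> (8 * r + 8 <= t)%N ->
  8 * eta <= delta * eps ^+ 2 / (128 * r%:R) ->
  eps ^+ 2 * N <= t%:R ^+ 2 \/ eps * D%:R <= t%:R ->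
  mon t <= hom t * (1 - delta * eps ^+ 2 / (128 * r%:R) / 4).
Proof.
move=> /andP[eps0 eps1] mt rt; set beta := delta * eps ^+ 2 / (128 * r%:R) => eta_le tlb.
have r1 : 1 <= r%:R :> R by rewrite ler1n.
have d0 := delta_gt0; have d1 := delta_le1.
have r128 : 0 < 128 * r%:R :> R by rewrite mulr_gt0 // ltr0n.
have beta0 : 0 < beta by rewrite !divr_gt0 // mulr_gt0 // exprn_gt0.
have beta_eps : beta <= eps / 8.
  rewrite ler_pdivrMr //; apply: (@le_trans _ _ (eps ^+ 2)).
    by rewrite ler_piMl // sqr_ge0.
  rewrite expr2; nra.
have [T1 T2 M_ge j_ge] := split_time r_gt0 mt rt.
have walk_ub : exists2 T, (T + m <= t)%N &
    forall x : V, walkE (R := R) e D T x (fun s => (uniq s)%:R) <= (1 + beta)^-1.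
  case: tlb => tlb.
    exists (t %/ 4 + t %/ (8 * r) * (2 * r))%N => // x.
    apply: le_trans (uniq_birthday ereg D_gt0 r2_gt0 d0 d1 V_gt0 johnson_doeblin _ _ x) _.
    clear T1 T2; move: (t %/ 4)%N (t %/ (8 * r))%N M_ge j_ge => M j M_ge j_ge.
    have pos : 0 <= j%:R * (delta * M%:R / N) by rewrite mulr_ge0 // divr_ge0 // mulr_ge0 // ltW.
    rewrite lef_pV2 ?posrE ?ltr_pwDl ?(ltW beta0) // lerD2l.
    rewrite /beta ler_pdivrMr //.
    (* The constant [128 * r] is the product of the [8] and [16 * r] of [split_time]. *)
    have -> : j%:R * (delta * M%:R / N) * (128 * r%:R) =
      delta * ((8 * M%:R) * (16 * r%:R * j%:R) / N) by field; rewrite gt_eqF.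
    rewrite ler_pM2l // ler_pdivlMr //; apply: le_trans tlb _.
    rewrite expr2; apply: ler_pM => //; first by rewrite -natrM ler_nat.
    by rewrite -!natrM ler_nat.
  exists (t %/ 4).+2 => // x; apply: le_trans (uniq_nobacktrack R esym ereg D_gt0 _ x) _.
  have D1 : 1 <= D%:R :> R by rewrite ler1n.
  apply: le_trans (one_sub_pow_le _ _) _.
    by rewrite invr_ge0 ler0n invf_le1.
  clear j_ge T1 T2; move: (t %/ 4)%N M_ge => M M_ge.
  rewrite lef_pV2 ?posrE ?ltr_pwDl ?(ltW beta0) ?mulr_ge0 ?invr_ge0 // lerD2l.
  apply: le_trans beta_eps _; rewrite ler_pdivlMr // mulrAC ler_pdivrMr //.
  have : t%:R <= 8 * M%:R :> R by rewrite -natrM ler_nat.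
  lra.
have [T Tt Tq] := walk_ub.
have q0 : 0 <= (1 + beta)^-1 by rewrite invr_ge0; lra.
have t0 : (0 < t)%N by apply: leq_trans rt; rewrite addn_gt0 orbT.
have h := @mon_le R V e D esym D_gt0 V_gt0 t T m eta _ Tt t0 q0 eta_ge0 johnson_mix Tq.
have eta1 : 0 < 1 - eta by lra.
rewrite -(ler_pM2r eta1); apply: le_trans h _.
rewrite -mulrA ler_wpM2l // ler_pdivrMr; last lra.
have b1 : beta <= 1 by lra.
(* [8 eta <= beta] gives [1 + eta <= (1 - eta) (1 + beta / 2)], and [beta <= 1] gives [1 + beta / 2
   <= (1 - beta / 4) (1 + beta)]. *)
apply: (@le_trans _ _ ((1 - eta) * (1 + beta / 2))); first by nra.
have -> : (1 - beta / 4) * (1 - eta) * (1 + beta) = (1 - eta) * ((1 - beta / 4) * (1 + beta)) by ring.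
by rewrite ler_wpM2l ?(ltW eta1) //; nra.
Qed.

End Mixing.
End Johnson.

(** * Logarithmic mixing times against powers of [n] *)

(** The quotient [(l + 1) ^ 4 / 2 ^ l] peaks at [l = 5] with value 40.5; for larger [l] one has
    [(l + 2) ^ 4 <= 2 (l + 1) ^ 4]. *)
Lemma trunc_log_pow4 n : (0 < n)%N -> ((trunc_log 2 n).+1 ^ 4 <= 41 * n)%N.
Proof.
move=> n0; apply: (@leq_trans (41 * 2 ^ trunc_log 2 n)); last first.
  by rewrite leq_mul // trunc_logP.
elim: (trunc_log 2 n) => [//|l IH].
have [l5|l5] := leqP l 5; first by clear IH; do 6 (case: l l5 => [//|l l5]).
apply: (@leq_trans (2 * l.+1 ^ 4)); last by rewrite [(2 ^ l.+1)%N]expnS mulnCA leq_mul2l IH.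
clear IH; rewrite !expnS !expn0; nia.
Qed.

(** The mixing time [m] for [J] equal to [C] times the logarithm of [n]. *)
Definition mixing_time (r C n : nat) : nat := (C * (trunc_log 2 n).+1 * (2 * r)).+1.

(** Both sides are squared: the fourth power of the mixing time is [O(n)], eventually below
    [eps ^ 2 * n ^ 2]. *)
Lemma mixing_time_small (R : realType) (r C : nat) (eps : R) : 0 < eps ->
  \forall n \near \oo%classic, (mixing_time r C n)%:R ^+ 2 <= eps * n%:R.
Proof.
move=> eps0; pose B := ((2 * r * C).+1 ^ 4 * 41)%N.
near=> n; have n0 : (0 < n)%N by near: n; exact: nbhs_infty_gt.
have mB : (mixing_time r C n ^ 4 <= B * n)%N.
  have mL : (mixing_time r C n <= (2 * r * C).+1 * (trunc_log 2 n).+1)%N.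
    by rewrite /mixing_time; nia.
  rewrite -mulnA; apply: (@leq_trans (((2 * r * C).+1 * (trunc_log 2 n).+1) ^ 4)).
    by rewrite leq_exp2r.
  by rewrite expnMn leq_mul // trunc_log_pow4.
have nB : B%:R / eps ^+ 2 <= n%:R by near: n; exact: nbhs_infty_ger.
rewrite -(@ler_pXn2r _ 2) ?nnegrE ?exprn_ge0 ?mulr_ge0 ?(ltW eps0) //.
rewrite -exprM -natrX; apply: (@le_trans _ _ (B * n)%N%:R); first by rewrite ler_nat.
rewrite natrM (_ : (eps * n%:R) ^+ 2 = eps ^+ 2 * n%:R * n%:R); last by ring.
by rewrite ler_wpM2r // [leRHS]mulrC -ler_pdivrMr ?exprn_gt0.
Unshelve. all: by end_near.
Qed.

(** Choose [C] with [(1 - delta) ^ C <= 2 ^ - (r + 1)]; as [n <= 2 ^ L], the power [L] of this is at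
    most [n ^ - (r + 1)]. *)
Lemma geometric_beats_power (R : realType) (delta : R) (r : nat) : 0 < delta <= 1 ->
  exists C, forall n, (0 < n)%N ->
    (1 - delta) ^+ (C * (trunc_log 2 n).+1) * (n ^ r)%:R <= n%:R^-1.
Proof.
move=> /andP[d0 d1]; have [C CB] : exists C : nat, 2 ^+ r.+1 / delta <= C%:R.
  exists (Num.bound (2 ^+ r.+1 / delta)); apply/ltW/archi_boundP.
  by rewrite divr_ge0 ?exprn_ge0 // ltW.
exists C => n n0; set L := (trunc_log 2 n).+1.
have nL : n%:R <= 2 ^+ L :> R by rewrite -natrX ler_nat ltnW // trunc_log_ltn.
have nR : 0 < n%:R :> R by rewrite ltr0n.
have CL : (1 - delta) ^+ C <= (2 ^+ r.+1)^-1.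
  apply: le_trans (one_sub_pow_le C _) _; first by rewrite ltW.
  rewrite lef_pV2 ?posrE ?exprn_gt0 // ?ltr_pwDl ?mulr_ge0 ?(ltW d0) //.
  by move: CB; rewrite ler_pdivrMr //; lra.
rewrite -[leRHS]mul1r ler_pdivlMr // -mulrA -natrM -expnSr natrX exprM.
apply: (@le_trans _ _ ((2 ^+ r.+1)^-1 ^+ L * (2 ^+ L) ^+ r.+1)).
  by rewrite ler_pM ?exprn_ge0 ?subr_ge0 // ?lerXn2r ?nnegrE ?exprn_ge0 ?subr_ge0 ?invr_ge0.
by rewrite exprVn -!exprM mulnC mulVf // expf_neq0.
Qed.

(** * Passage to the limit *)

Section Limits.
Variables (R : realType) (r s : nat) (t : nat -> nat).
Hypothesis sr : (s < r)%N.
Hypothesis t_ge3 : forall n, (3 <= t n)%N.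

Let N n : R := (johnsonN n r)%:R.
Let D n : R := (johnsonN1 n r s)%:R.
Let mu n : R := Num.min (Num.sqrt (N n)) (D n).
Let hom n : R := (hom_count (cycle_rel (t n)) (johnson_rel n r s))%:R.
Let mon n : R := (mon_count (cycle_rel (t n)) (johnson_rel n r s))%:R.
Let del : R := delta R r.
Let r_gt0 : (0 < r)%N. Proof. exact: leq_ltn_trans sr. Qed.
Let large := n_min r.
Let K : R := (bin_cst r)%:R.

Let card_johnson n : #|{: jvert n r}| = johnsonN n r. Proof. exact: card_jvert. Qed.

Let del_bounds : 0 < del <= 1.
Proof. by rewrite delta_gt0 delta_le1. Qed.

Let K_gt0 : 0 < K. Proof. by rewrite ltr0n muln_gt0 expn_gt0 fact_gt0. Qed.

Let N_lb n : (large <= n)%N -> n%:R <= K * N n.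
Proof.
by move=> nl; rewrite -natrM ler_nat -card_johnson; exact: (johnson_n_le_card sr).
Qed.

Let D_lb n : (large <= n)%N -> n%:R <= K * D n.
Proof. by move=> nl; rewrite -natrM ler_nat; exact: johnson_n_le_deg. Qed.

Let D_ge1 n : (large <= n)%N -> 1 <= D n.
Proof. by move=> nl; rewrite ler1n; exact: johnson_deg_gt0. Qed.

Let N_gt0 n : (large <= n)%N -> 0 < N n.
Proof. by move=> nl; rewrite ltr0n -card_johnson; exact: (johnson_card_gt0 sr). Qed.

Let mu_gt0 n : (large <= n)%N -> 0 < mu n.
Proof.
by move=> nl; rewrite lt_min sqrtr_gt0 N_gt0 // (lt_le_trans _ (D_ge1 nl)).
Qed.

(** Ensures that [t >= eps * mu] makes [t ^ 2] at least of order [n], so that [t] exceeds twice the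
    mixing time. *)
Let mu_sqr_lb n : (large <= n)%N -> n%:R <= K * mu n ^+ 2.
Proof.
move=> nl; rewrite /mu; case: (leP (Num.sqrt (N n)) (D n)) => _.
  by rewrite sqr_sqrtr ?N_lb // ltW // N_gt0.
apply: le_trans (D_lb nl) _; rewrite ler_pM2l // expr2 ler_peMl ?D_ge1 //.
Qed.

(** Supplies the hypothesis [mixed] with [eta = 1 / n]. *)
Let mixing_rate : exists C, forall n, (large <= n)%N -> (0 < n)%N ->
  (1 - del) ^+ (C * (trunc_log 2 n).+1) * (#|{: jvert n r}|)%:R <= n%:R^-1.
Proof.
have [C h] := geometric_beats_power r del_bounds; exists C => n nl n0.
apply: le_trans (h n n0); rewrite ler_wpM2l ?exprn_ge0 ?subr_ge0 //.
  by have /andP[] := del_bounds.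
by rewrite ler_nat johnson_card_ub.
Qed.

Lemma ratio_sufficient :
  ((fun n => (t n)%:R / mu n) @ \oo --> (0 : R))%classic ->
  ((fun n => mon n / hom n) @ \oo --> (1 : R))%classic.
Proof.
move=> /cvgrPdist_le tau0; have [C mixed] := mixing_rate.
pose A : R := 4 / gamma R r ^+ 4 + 16 * r%:R / del + 8.
have A_gt0 : 0 < A.
  have /andP[d0 _] := del_bounds.
  by rewrite ltr_wpDl // addr_ge0 // divr_ge0 ?mulr_ge0 ?exprn_ge0 ?invr_ge0 // ltW.
apply/cvgrPdist_le => eps eps0.
(* Each of the three terms of [johnson_sufficient] will be at most [e]; the cap at 1 gives
   [e ^ 2 <= e] for the term in [t ^ 2 / N]. *)
pose e := Num.min 1 (eps / (3 * A)).
have e0 : 0 < e by rewrite lt_min ltr01 divr_gt0 // mulr_gt0.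
have e1 : e <= 1 by rewrite ge_min lexx.
have eA : 3 * A * e <= eps by rewrite mulrC -ler_pdivlMr ?mulr_gt0 // ge_min lexx orbT.
have eK : 0 < e / K by rewrite divr_gt0.
near=> n.
have nl : (large <= n)%N by near: n; exact: nbhs_infty_ge.
have n2 : 2 <= n%:R :> R by near: n; exact: nbhs_infty_ger.
have n0 : (0 < n)%N by rewrite -(ltr0n R); lra.
have small : (mixing_time r C n)%:R ^+ 2 <= e / K * n%:R by near: n; exact: mixing_time_small.
have tau_e : (t n)%:R / mu n <= e.
  have : `|0 - (t n)%:R / mu n| <= e by near: n; exact: tau0.
  by rewrite sub0r normrN; apply: le_trans; exact: ler_norm.
have t1 : (1 < t n)%N by exact: ltnW (t_ge3 n).
have hom0 : 0 < hom n by exact: johnson_hom_gt0.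
have mon_hom : mon n <= hom n.
  rewrite ler_nat; apply/subset_leq_card/fintype.subsetP => f.
  by rewrite !inE => /andP[].
rewrite ger0_norm; last by rewrite subr_ge0 ler_pdivrMr // mul1r.
have -> : 1 - mon n / hom n = (hom n - mon n) / hom n by field; rewrite gt_eqF.
rewrite ler_pdivrMr // mulrC.
have n_inv : n%:R^-1 <= 2^-1 :> R by rewrite lef_pV2 ?posrE //; lra.
have n_inv0 : 0 <= n%:R^-1 :> R by rewrite invr_ge0.
have := johnson_sufficient sr nl n_inv0 (mixed n nl n0) t1 n_inv.
move=> h; apply: le_trans h _; rewrite ler_wpM2l ?(ltW hom0) //.
rewrite -/del -/A; apply: le_trans _ eA; rewrite [leRHS](_ : _ = A * (3 * e)); last by ring.
rewrite ler_pM2l //.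
have D1 := D_ge1 nl; have D0 : 0 < D n by lra.
have N0 := N_gt0 nl; have m0 := mu_gt0 nl.
have x1 : (mixing_time r C n)%:R ^+ 2 / D n <= e.
  rewrite ler_pdivrMr //; apply: le_trans small _.
  by rewrite -mulrA ler_pM2l // ler_pdivrMl // D_lb.
have x2 : (t n)%:R / D n <= e.
  apply: le_trans tau_e; rewrite ler_wpM2l // lef_pV2 ?posrE //.
  by rewrite ge_min lexx orbT.
have x3 : (t n)%:R ^+ 2 / N n <= e.
  apply: (@le_trans _ _ (((t n)%:R / mu n) ^+ 2)).
    rewrite expr_div_n ler_wpM2l ?exprn_ge0 // lef_pV2 ?posrE ?exprn_gt0 //.
    have : mu n <= Num.sqrt (N n) by rewrite ge_min lexx.
    move=> muN; rewrite -[N n in leRHS](sqr_sqrtr (ltW N0)).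
    by rewrite lerXn2r ?nnegrE ?sqrtr_ge0 // ltW.
  apply: (@le_trans _ _ (e ^+ 2)); last by rewrite expr2 ler_piMr // ltW.
  by rewrite lerXn2r ?nnegrE ?(ltW e0) // divr_ge0 // ltW.
rewrite card_johnson; apply: le_trans (lerD (lerD x1 x2) x3) _; lra.
Unshelve. all: by end_near.
Qed.

(** If [t / mu] exceeded [eps] at some large [n], the ratio would be at most [1 - beta / 4],
    although it is eventually within [beta / 8] of 1. *)
Lemma ratio_necessary :
  ((fun n => mon n / hom n) @ \oo --> (1 : R))%classic ->
  ((fun n => (t n)%:R / mu n) @ \oo --> (0 : R))%classic.
Proof.
move=> /cvgrPdist_le ratio1; have [C mixed] := mixing_rate.
apply/cvgrPdist_le => eps' eps'0; pose eps := Num.min 1 eps'.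
have eps0 : 0 < eps by rewrite lt_min ltr01.
have eps1 : eps <= 1 by rewrite ge_min lexx.
have /andP[d0 d1] := del_bounds.
pose beta := del * eps ^+ 2 / (128 * r%:R).
have beta0 : 0 < beta.
  by apply: divr_gt0; apply: mulr_gt0; rewrite ?exprn_gt0 ?ltr0n.
have e4 : 0 < eps ^+ 2 / (4 * K) by apply: divr_gt0; [exact: exprn_gt0|exact: mulr_gt0].
have b8 : 0 < beta / 8 by rewrite divr_gt0.
near=> n.
have nl : (large <= n)%N by near: n; exact: nbhs_infty_ge.
have n0 : (0 < n)%N by near: n; exact: nbhs_infty_gt.
have nR0 : 0 < n%:R :> R by rewrite ltr0n.
(* This and the next two thresholds yield [8 * eta <= beta] for [eta = 1 / n], [8 * r + 8 <= t] and
   [2 * m <= t]. *)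
have n_beta : 8 / beta <= n%:R by near: n; exact: nbhs_infty_ger.
have n_r : (8 * r + 8)%:R ^+ 2 * (K / eps ^+ 2) <= n%:R by near: n; exact: nbhs_infty_ger.
have small : (mixing_time r C n)%:R ^+ 2 <= eps ^+ 2 / (4 * K) * n%:R.
  by near: n; exact: mixing_time_small.
have near1 : `|1 - mon n / hom n| <= beta / 8 by near: n; exact: ratio1.
have m0 := mu_gt0 nl; have N0 := N_gt0 nl.
rewrite sub0r normrN ger0_norm; last by rewrite divr_ge0 // ltW.
rewrite leNgt; apply/negP => tau_big.
have t_mu : eps * mu n <= (t n)%:R.
  rewrite -ler_pdivlMr //; apply: ltW; apply: le_lt_trans tau_big.
  by rewrite ge_min lexx orbT.
have t_n : eps ^+ 2 / K * n%:R <= (t n)%:R ^+ 2.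
  apply: (@le_trans _ _ ((eps * mu n) ^+ 2)); last first.
    by rewrite lerXn2r ?nnegrE // mulr_ge0 // ltW.
  by rewrite exprMn -mulrA ler_pM2l ?exprn_gt0 // ler_pdivrMl // mu_sqr_lb.
have sq_le (a b : nat) : (a%:R ^+ 2 <= b%:R ^+ 2 :> R) -> (a <= b)%N.
  by rewrite -!natrX ler_nat leq_sqr.
have mt : (2 * mixing_time r C n <= t n)%N.
  apply: sq_le; apply: le_trans t_n; rewrite natrM exprMn.
  apply: (@le_trans _ _ (2 ^+ 2 * (eps ^+ 2 / (4 * K) * n%:R))); first by rewrite ler_pM2l ?exprn_gt0.
  rewrite le_eqVlt; apply/orP; left; apply/eqP; field.
  by rewrite gt_eqF.
have rt : (8 * r + 8 <= t n)%N.
  apply: sq_le; apply: le_trans t_n.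
  apply: (@le_trans _ _ (eps ^+ 2 / K * ((8 * r + 8)%:R ^+ 2 * (K / eps ^+ 2)))).
    rewrite le_eqVlt; apply/orP; left; apply/eqP; field.
    by rewrite !gt_eqF ?exprn_gt0.
  by rewrite ler_pM2l // divr_gt0 // exprn_gt0.
have eta_le : 8 * n%:R^-1 <= beta by rewrite ler_pdivrMr // mulrC -ler_pdivrMr.
have tlb : eps ^+ 2 * (#|{: jvert n r}|)%:R <= (t n)%:R ^+ 2 \/ eps * D n <= (t n)%:R.
  rewrite card_johnson -/(N n); move: t_mu; rewrite /mu.
  case: (leP (Num.sqrt (N n)) (D n)) => _ h; [left|by right].
  rewrite -[N n](sqr_sqrtr (ltW N0)) -exprMn.
  by rewrite lerXn2r ?nnegrE ?mulr_ge0 ?sqrtr_ge0 ?(ltW eps0).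
have eps01 : 0 < eps <= 1 by rewrite eps0.
have n_inv0 : 0 <= n%:R^-1 :> R by rewrite invr_ge0.
have h := johnson_necessary sr nl n_inv0 (mixed n nl n0) eps01 mt rt eta_le tlb.
have hom0 : 0 < hom n by apply: johnson_hom_gt0 => //; exact: ltnW (t_ge3 n).
have : mon n / hom n <= 1 - beta / 4 by rewrite ler_pdivrMr // mulrC.
move: near1; rewrite ler_norml => /andP[_ ]; lra.
Unshelve. all: by end_near.
Qed.

End Limits.

Local Open Scope classical_set_scope.

Theorem theorem2 (R : realType) (r s : nat) (t : nat -> nat) :
  (s < r)%N -> (forall n, (3 <= t n)%N) ->
  ((fun n : nat =>
      ((mon_count (cycle_rel (t n)) (johnson_rel n r s))%:R /
       (hom_count (cycle_rel (t n)) (johnson_rel n r s))%:R : R))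
     @ \oo --> (1 : R))
  <->
  ((fun n : nat =>
      ((t n)%:R / Num.min (Num.sqrt ((johnsonN n r)%:R)) ((johnsonN1 n r s)%:R) : R))
     @ \oo --> (0 : R)).
Proof.
by move=> sr t3; split; [exact: ratio_necessary|exact: ratio_sufficient].
Qed.
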